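(* Let $\alpha\in(1,2)$ and let $X=(X_t)_{t\ge0}$ be a stable process with index $\alpha$ such that $\mathbb{E}(e^{-qX_t})=\exp(tq^\alpha)$ for all $t>0$, $q\ge0$. Then $h_1(x,t)>0$ for all $x<1$ and $t>0$.
   Context: $X$ is a Lévy process with $X_0=0$; under the stated normalization it is spectrally positive and strictly stable. $\overline X_t=\sup_{0\le s\le t}X_s$. For $c>0$, $t>0$, $x\in(-\infty,c)$, $h_c(x,t)=\mathbb{P}\{X_t\in dx,\ \overline X_t\le c\}/dx$, i.e. $h_c(\cdot,t)$ is the density on $(-\infty,c)$ of $A\mapsto\mathbb{P}\{X_t\in A,\ \overline X_t\le c\}$ (the version continuous in $x$). *)

(* Defs.v *)
From HB Require Import structures.
From mathcomp Require Import all_boot all_order all_algebra.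
From mathcomp Require Import all_classical all_reals all_analysis.

Set Implicit Arguments.
Unset Strict Implicit.
Unset Printing Implicit Defensive.

Import Order.TTheory GRing.Theory Num.Theory.
Import numFieldNormedType.Exports.

Local Open Scope classical_set_scope.
Local Open Scope ring_scope.
Local Open Scope ereal_scope.

(* Throughout, a process is a family of real random variables indexed by R of
   which only the members with nonnegative index are ever constrained. *)

(* For a finite family the product rule over subfamilies is the case where some
   of the sets [B i] are [setT]. *)
Definition mutually_independent d (T : measurableType d) (R : realType)
    (P : probability T R) (n : nat) (Y : 'I_n -> T -> R) : Prop :=
  forall B : 'I_n -> set R, (forall i, measurable (B i)) ->
    P (\bigcap_(i in [set: 'I_n]) (Y i @^-1` B i)) =
    \prod_(i < n) P (Y i @^-1` B i).

(* Equality in law of two processes. The measurable rectangles form a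
   pi-system generating the Borel sigma-algebra of R^n, so this is equality of
   all finite-dimensional distributions. *)
Definition same_law d (T : measurableType d) (R : realType)
    (P : probability T R) (Y Z : R -> T -> R) : Prop :=
  forall (n : nat) (t : 'I_n -> R) (B : 'I_n -> set R),
    (forall i, (0 <= t i)%R) -> (forall i, measurable (B i)) ->
    P (\bigcap_(i in [set: 'I_n]) (Y (t i) @^-1` B i)) =
    P (\bigcap_(i in [set: 'I_n]) (Z (t i) @^-1` B i)).

Definition cadlag (R : realType) (f : R -> R) : Prop :=
  (forall t : R, (0 <= t)%R -> f s @[s --> t^'+] --> f t) /\
  (forall t : R, (0 < t)%R -> cvg (f s @[s --> t^'-])).

Record levy_process d (T : measurableType d) (R : realType)
    (P : probability T R) (X : R -> {RV P >-> R}) : Prop := LevyProcess {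
  levy0 : forall w, X 0%R w = 0%R ;
  levy_cadlag : forall w, cadlag (fun t => X t w) ;
  levy_independent : forall (n : nat) (t : nat -> R),
    (0 <= t 0%N)%R -> nondecreasing_seq t ->
    mutually_independent P
      (fun (i : 'I_n) w => (X (t i.+1) w - X (t i) w)%R) ;
  levy_stationary : forall (s t : R) (B : set R),
    (0 <= s)%R -> (0 <= t)%R -> measurable B ->
    P [set w | B (X (s + t)%R w - X s w)%R] = P (X t @^-1` B) }.

(* Stability in the wide sense: a deterministic drift is allowed, strict
   stability being the case [b = 0]. *)
Definition stable_process d (T : measurableType d) (R : realType)
    (P : probability T R) (alpha : R) (X : R -> {RV P >-> R}) : Prop :=
  levy_process X /\
  forall a : R, (0 < a)%R -> exists b : R,
    same_law P (fun t w => X (a * t)%R w)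
               (fun t w => (a `^ alpha^-1 * X t w + b * t)%R).

Definition running_sup (T : Type) (R : realType) (X : R -> T -> R) (t : R)
    (w : T) : \bar R :=
  ereal_sup [set (X s w)%:E | s in `[0%R, t]].

(* [f] is the version continuous on (-oo, c) of the density of
   A |-> P (X_t \in A, sup_(0 <= s <= t) X_s <= c); continuity determines its
   values on (-oo, c), and its values elsewhere are irrelevant. *)
Definition is_killed_density d (T : measurableType d) (R : realType)
    (P : probability T R) (X : R -> T -> R) (c t : R) (f : R -> R) : Prop :=
  (forall x : R, (x < c)%R -> {for x, continuous f}) /\
  (forall A : set R, measurable A -> A `<=` `]-oo, c[ ->
     P [set w | A (X t w) /\ running_sup X t w <= c%:E] =
     \int[lebesgue_measure]_(x in A) (f x)%:E).

(* Main.v *)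
Require Import Defs.
From HB Require Import structures.
From mathcomp Require Import all_boot all_order all_algebra.
From mathcomp Require Import all_classical all_reals all_analysis.
From mathcomp Require Import measurable_realfun ring lra.

(* Call (t, y) a tight move if, for every e > 0, with positive probability X_t
   is within e of y while X stays below max(0, y) + e on [0, t]. By the
   independence of increments tight moves may be added, negative ones first,
   and by strict stability (t, y) may be scaled to (a t, a^(1/alpha) y). A path
   run up to a near-maximum gives an upward tight move, and a path run from a
   near-maximum gives a downward one; both exist because the Laplace exponent
   q^alpha with alpha > 1 forces X_1 to charge both half-lines. Since n moves
   of duration t/n cover a distance of order n^(1 - 1/alpha), an intermediate
   value argument shows that every (t, y) is tight. Hence h_1(., t/2) is
   positive on a dense open set, and
     h_1(x, t) >= int_(x-1)^0 h_1(y, t/2) h_1(x - y, t/2) dy > 0,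
   because a path that is below 0 at time t/2 may still rise by 1. *)

Set Implicit Arguments.
Unset Strict Implicit.
Unset Printing Implicit Defensive.

Import Order.TTheory GRing.Theory Num.Theory.
Import numFieldNormedType.Exports.

Local Open Scope classical_set_scope.
Local Open Scope ring_scope.

(** * Laws of random vectors *)

(** The Laplace transform is the only quantitative input: neither the jumps of X nor the law of its
    supremum enter. A near-maximum occurs at a random time, but confining it to dyadic times, and
    its value to bins, leaves countably many deterministic cases; independence of increments at
    fixed times then suffices, without stopping times. The order of quantifiers shapes the middle of
    the proof. The size [eta] of the elementary moves must not depend on the slack [e]: the number
    of moves needed to cover |y| is computed from [eta], and the slack granted to each move depends
    on that number. The density [h1] is known only through its continuity and its integrals, its
    sign included. A positive probability therefore gives positivity somewhere in each interval, not
    at a prescribed point. A midpoint y with both h_1(y, t/2) and h_1(x - y, t/2) positive is found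
    because an open set where the first factor is positive meets the reflection of a dense set. *)

Definition rectangles (R : realType) (n : nat) : set_system ('I_n -> R) :=
  [set A | exists2 B : 'I_n -> set R,
     (forall i, measurable (B i)) & A = [set v | forall i, B i (v i)]].

Lemma rectangles_setI (R : realType) n : setI_closed (@rectangles R n).
Proof.
move=> _ _ [B mB ->] [C mC ->]; exists (fun i => B i `&` C i).
  by move=> i; exact: measurableI.
by apply/seteqP; split=> v /= => [[Bv Cv] i|BC]; split => // i; have [] := BC i.
Qed.

Lemma measurable_coord (R : realType) n (i : 'I_n) :
  measurable_fun setT (fun v : g_sigma_algebraType (@rectangles R n) => v i).
Proof.
move=> _ B mB; rewrite setTI; apply: sub_sigma_algebra.
exists (fun j => if j == i then B else setT) => [j|]; first by case: ifP.
apply/seteqP; split=> v /= => [Bv j|/(_ i)]; last by rewrite eqxx.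
by case: ifP => [/eqP->|].
Qed.

Lemma measurable_vec d (T : measurableType d) (R : realType) n
    (Y : 'I_n -> T -> R) (mY : forall i, measurable_fun setT (Y i)) :
  measurable_fun setT ((fun w i => Y i w) : T -> g_sigma_algebraType (@rectangles R
    n)).
Proof.
apply: (@measurability _ _ T (g_sigma_algebraType (@rectangles R n)) setT _
  (@rectangles R n)) => //.
move=> _ [_ [B mB ->] <-]; rewrite setTI.
rewrite [X in measurable X](_ : _ = \bigcap_(i in [set: 'I_n]) (Y i @^-1` B i)).
  apply: fin_bigcap_measurable => // i _.
  by rewrite -[X in measurable X]setTI; exact: mY.
by apply/seteqP; split=> w /= H i; [move=> _; exact: H|exact: H].
Qed.

(** Dynkin's pi-lambda argument. It is stated for finite measures rather than probabilities so that
    it applies to restrictions and multiples of [P]. *)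
Lemma eq_rectangles_law d (T : measurableType d) (R : realType)
    (m1 m2 : {measure set T -> \bar R}) (m1T : (m1 setT < +oo)%E) n (Y Z : 'I_n -> T
      -> R)
    (mY : forall i, measurable_fun setT (Y i))
    (mZ : forall i, measurable_fun setT (Z i)) :
  (forall B : 'I_n -> set R, (forall i, measurable (B i)) ->
     m1 [set w | forall i, B i (Y i w)] = m2 [set w | forall i, B i (Z i w)]) ->
  forall S : set (g_sigma_algebraType (@rectangles R n)), measurable S ->
  m1 [set w | S (Y^~ w)] = m2 [set w | S (Z^~ w)].
Proof.
move=> m12.
have mYS (S : set (g_sigma_algebraType (@rectangles R n))) : measurable S ->
    measurable [set w | S (Y^~ w)].
  by move=> mS; have := measurable_vec mY measurableT mS; rewrite setTI.
have mZS (S : set (g_sigma_algebraType (@rectangles R n))) : measurable S ->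
    measurable [set w | S (Z^~ w)].
  by move=> mS; have := measurable_vec mZ measurableT mS; rewrite setTI.
have mT : m1 setT = m2 setT.
  have := m12 (fun=> setT) (fun=> measurableT).
  have allT (W : 'I_n -> T -> R) : [set w | forall i, [set: R] (W i w)] = setT.
    by apply/seteqP; split.
  by rewrite !allT => ->.
apply: (@dynkin_induction _ (g_sigma_algebraType (@rectangles R n))
  (@rectangles R n) (fun S => m1 [set w | S (Y^~ w)] = m2 [set w | S (Z^~ w)])) => //.
- exact: rectangles_setI.
- by move=> _ [B mB ->]; exact: m12.
- move=> S mS IH.
  have -> : [set w | (~` S) (Y^~ w)] = setT `\` [set w | S (Y^~ w)].
    by rewrite setTD.
  have -> : [set w | (~` S) (Z^~ w)] = setT `\` [set w | S (Z^~ w)].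
    by rewrite setTD.
  have m2T : (m2 setT < +oo)%E by rewrite -mT.
  rewrite (measureD measurableT (mYS _ mS) m1T).
  rewrite (measureD measurableT (mZS _ mS) m2T) !setTI; congr (_ - _)%E;
    [exact: mT|exact: IH].
- move=> F mF tF IH.
  have bY (W : 'I_n -> T -> R) : [set w | (\bigcup_k F k) (W^~ w)] =
    \bigcup_k [set w | F k (W^~ w)] by [].
  rewrite !bY !measure_bigcup//.
  + by apply: eq_eseriesr => k _; exact: IH.
  + by move=> k _; exact: mZS.
  + by move=> i j _ _ [w [Fi Fj]]; apply: (tF i j) => //; exists (Z^~ w).
  + by move=> k _; exact: mYS.
  + by move=> i j _ _ [w [Fi Fj]]; apply: (tF i j) => //; exists (Y^~ w).
Qed.

Lemma measurable_rect d (T : measurableType d) (R : realType) n (Y : 'I_n -> T -> R)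
    (mY : forall i, measurable_fun setT (Y i)) (B : 'I_n -> set R)
    (mB : forall i, measurable (B i)) :
  measurable [set w | forall i, B i (Y i w)].
Proof.
have mS : measurable ([set v | forall i,
  B i (v i)] : set (g_sigma_algebraType (@rectangles R n))).
  by apply: sub_sigma_algebra; exists B.
by have := measurable_vec mY measurableT mS; rewrite setTI.
Qed.

(** One factor is extended at a time: with the other event fixed, [P] restricted to it and [P]
    multiplied by its probability are finite measures to which the previous lemma applies. [V] and
    [W] are kept apart because [V] will be increments of a shifted process and [W] those of X, so
    that independence and equality in law come together. *)
Lemma eq_rectangles_indep d (T : measurableType d) (R : realType)
    (P : probability T R) m n (U : 'I_m -> T -> R) (V W : 'I_n -> T -> R)
    (mU : forall i, measurable_fun setT (U i))
    (mV : forall i, measurable_fun setT (V i))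
    (mW : forall i, measurable_fun setT (W i)) :
  (forall (B : 'I_m -> set R) (C : 'I_n -> set R),
     (forall i, measurable (B i)) -> (forall i, measurable (C i)) ->
     P ([set w | forall i, B i (U i w)] `&` [set w | forall i, C i (V i w)]) =
     (P [set w | forall i, B i (U i w)] * P [set w | forall i, C i (W i w)])%E) ->
  forall (S : set (g_sigma_algebraType (@rectangles R m)))
    (S' : set (g_sigma_algebraType (@rectangles R n))),
  measurable S -> measurable S' ->
  P ([set w | S (U^~ w)] `&` [set w | S' (V^~ w)]) =
  (P [set w | S (U^~ w)] * P [set w | S' (W^~ w)])%E.
Proof.
move=> rect S S' mS mS'.
have mSU : measurable [set w | S (U^~ w)].
  by have := measurable_vec mU measurableT mS; rewrite setTI.
have Pfin (E : set T) : measurable E -> (P E < +oo)%E.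
  by move=> mE; rewrite (le_lt_trans (probability_le1 _ mE)) ?ltry.
have PE (E : set T) (mE : measurable E) :
    P E = ((NngNum (fine_ge0 (measure_ge0 P E)))%:num)%:E.
  by rewrite /= fineK// fin_num_measure.
have step1 (C : 'I_n -> set R) : (forall i, measurable (C i)) ->
    P ([set w | S (U^~ w)] `&` [set w | forall i, C i (V i w)]) =
    (P [set w | S (U^~ w)] * P [set w | forall i, C i (W i w)])%E.
  move=> mC.
  have mCV := measurable_rect mV mC; have mCW := measurable_rect mW mC.
  have := @eq_rectangles_law _ _ _ (mrestr P mCV)
    (mscale (NngNum (fine_ge0 (measure_ge0 P [set w | forall i, C i (W i w)]))) P)
    (Pfin _ (measurableI _ _ measurableT mCV)) m U U mU mU.
  move=> /(_ _ S mS); rewrite /= /mrestr /mscale -PE// => -> //.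
    by rewrite muleC.
  by move=> B mB; rewrite rect// muleC.
have := @eq_rectangles_law _ _ _ (mrestr P mSU)
  (mscale (NngNum (fine_ge0 (measure_ge0 P [set w | S (U^~ w)]))) P)
  (Pfin _ (measurableI _ _ measurableT mSU)) n V W mV mW.
move=> /(_ _ S' mS'); rewrite /= /mrestr /mscale -PE// setIC => -> //.
by move=> C mC; rewrite setIC step1.
Qed.

(** * Path events and their dyadic discretizations *)

Lemma dyadic_right (R : realType) (t u e : R) (u0 : 0 <= u) (ut : u < t) (e0 : 0 <
  e) :
  exists n k, (k <= 2 ^ n)%N /\ u < t * (k%:R / (2 ^ n)%:R) < u + e.
Proof.
have t0 : 0 < t by exact: le_lt_trans ut.
pose n := Num.bound (t / e).
have tn : t / e < (2 ^ n)%:R.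
  apply: (lt_trans (archi_boundP _)); first by rewrite divr_ge0// ltW.
  by rewrite ltr_nat ltn_expl.
have n0 : 0 < (2 ^ n)%:R :> R by rewrite ltr0n expn_gt0.
have x0 : 0 <= u / t * (2 ^ n)%:R by rewrite mulr_ge0// ?divr_ge0// ltW.
have /andP[k1 k2] := truncn_itv x0.
(* The successor of the integer part puts the grid point strictly to the right of [u]; [u < t] keeps
   the index at most [2 ^ n]. *)
exists n, (Num.truncn (u / t * (2 ^ n)%:R)).+1; split.
  rewrite -(ltr_nat R); apply: (le_lt_trans k1).
  by rewrite gtr_pMl// ltr_pdivrMr// mul1r.
have uE : u * (2 ^ n)%:R = t * (u / t * (2 ^ n)%:R) by field; exact: lt0r_neq0.
apply/andP; split; rewrite mulrA.
  by rewrite ltr_pdivlMr// uE ltr_pM2l.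
rewrite ltr_pdivrMr// -addn1 natrD mulrDr mulr1 mulrDl uE.
by apply: ler_ltD; [rewrite ler_pM2l|rewrite mulrC -ltr_pdivrMr].
Qed.

(** A value above [c] at [u < t] would persist, by right continuity, at a dyadic point just after
    [u]. The endpoint [t], where the right limit leaves the interval, is itself a grid point. *)
Lemma dyadic_le (R : realType) (f : R -> R) (t : R) (c : \bar R) :
  (forall u, 0 <= u -> f s @[s --> u^'+] --> f u) ->
  (forall n k, (k <= 2 ^ n)%N -> ((f (t * (k%:R / (2 ^ n)%:R)))%:E <= c)%E) ->
  forall u, 0 <= u <= t -> ((f u)%:E <= c)%E.
Proof.
case: c => [r fr H|_ _ u _|_ /(_ 0%N 0%N isT)] //; last by rewrite leey.
move=> u /andP[u0]; rewrite le_eqVlt => /predU1P[->|ut].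
  by have := H 0%N 1%N isT; rewrite expn0 divr1 mulr1.
rewrite lee_fin leNgt; apply/negP => rfu.
have [e /= e0 He] := cvgr_gt (f u) (fr u u0) _ rfu.
have [n [k [kn /andP[k1 k2]]]] := dyadic_right u0 ut e0.
have := H n k kn; rewrite lee_fin leNgt => /negP; apply.
by apply: He => //=; rewrite ltr0_norm ?subr_lt0// opprB ltrBlDl.
Qed.

Definition grid (R : realType) (t : R) (n k : nat) : R := t * (k%:R / (2 ^ n)%:R).

(* [c] is extended so that [c = +oo] drops the constraint on the path. *)
Definition bounded_event T (R : realType) (U : R -> T -> R) (t : R) (B : set R)
    (c : \bar R) : set T :=
  [set w | B (U t w) /\ forall u, 0 <= u <= t -> ((U u w)%:E <= c)%E].

Definition grid_event T (R : realType) (U : R -> T -> R) (t : R) (B : set R)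
    (c : \bar R) (n : nat) : set T :=
  [set w | B (U t w) /\ forall k, (k <= 2 ^ n)%N -> ((U (grid t n k) w)%:E <= c)%E].

Definition right_continuous_paths T (R : realType) (U : R -> T -> R) :=
  forall w u, 0 <= u -> U s w @[s --> u^'+] --> U u w.

Lemma grid_ge0 (R : realType) (t : R) n k : 0 <= t -> 0 <= grid t n k.
Proof. by move=> t0; rewrite mulr_ge0// divr_ge0. Qed.

Lemma grid0 (R : realType) (t : R) n : grid t n 0 = 0.
Proof. by rewrite /grid mul0r mulr0. Qed.

Lemma grid_last (R : realType) (t : R) n : grid t n (2 ^ n) = t.
Proof. by rewrite /grid divff ?mulr1// pnatr_eq0 expn_eq0. Qed.

Lemma grid_le (R : realType) (t : R) n k k' : 0 <= t -> (k <= k')%N -> grid t n k <=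
  grid t n k'.
Proof. by move=> t0 kk; rewrite ler_wpM2l// ler_pM2r ?ler_nat// invr_gt0 ltr0n
  expn_gt0. Qed.

Lemma grid_double (R : realType) (t : R) n k : grid t n.+1 (k * 2) = grid t n k.
Proof.
rewrite /grid expnSr !natrM; field.
by rewrite pnatr_eq0 expn_eq0.
Qed.

Lemma bounded_event_bigcap T (R : realType) (U : R -> T -> R) t B c :
  right_continuous_paths U -> 0 <= t ->
  bounded_event U t B c = \bigcap_n grid_event U t B c n.
Proof.
move=> rU t0; apply/seteqP; split=> [w [Bw cw] n _|w H].
  split=> // k kn; apply: cw.
  by rewrite grid_ge0//= -[leRHS](grid_last t n) grid_le.
split; first by have [] := H 0%N Logic.I.
apply: dyadic_le => [u u0|n k kn]; first exact: rU.
by have [_] := H n Logic.I; exact.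
Qed.

Lemma grid_event_nonincreasing T (R : realType) (U : R -> T -> R) t B c :
  nonincreasing_seq (grid_event U t B c).
Proof.
apply/nonincreasing_seqP => n; rewrite subsetEset => w [Bw H]; split=> // k kn.
by rewrite -grid_double; apply: H; rewrite expnSr leq_mul2r kn orbT.
Qed.

Lemma measurable_le_ereal (R : realType) (c : \bar R) : measurable [set x : R |
  (x%:E <= c)%E].
Proof.
case: c => [r||].
- rewrite (_ : [set _ | _] = `]-oo, r]%classic); first exact: measurable_itv.
  by apply/seteqP; split => x /=; rewrite in_itv/= lee_fin.
- rewrite (_ : [set _ | _] = setT); first exact: measurableT.
  by apply/seteqP; split=> x //= _; rewrite leey.
- rewrite (_ : [set _ | _] = set0); first exact: measurable0.
  by apply/seteqP; split.
Qed.

Lemma measurable_grid_event d (T : measurableType d) (R : realType) (U : R -> T ->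
  R) t B c n :
  (forall u, measurable_fun setT (U u)) -> measurable B -> measurable (grid_event U
    t B c n).
Proof.
move=> mU mB.
have mpre u C : measurable C -> measurable (U u @^-1` C).
  by move=> mC; rewrite -[X in measurable X]setTI; exact: mU.
rewrite [X in measurable X](_ : _ = U t @^-1` B `&` \bigcap_(k in [set k | (k <= 2 ^
  n)%N])
    (U (grid t n k) @^-1` [set x | (x%:E <= c)%E])).
  apply: measurableI; first exact: mpre.
  apply: bigcap_measurableType => k _; apply: mpre; exact: measurable_le_ereal.
by apply/seteqP; split=> w [Bw H]; split.
Qed.

Lemma measurable_bounded_event d (T : measurableType d) (R : realType) (U : R -> T
  -> R) t B c :
  (forall u, measurable_fun setT (U u)) -> right_continuous_paths U -> 0 <= t ->
    measurable B ->
  measurable (bounded_event U t B c).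
Proof.
move=> mU rU t0 mB; rewrite bounded_event_bigcap//.
by apply: bigcapT_measurable => n; exact: measurable_grid_event.
Qed.

Lemma cvg_probability_bigcap d (T : measurableType d) (R : realType) (P :
  probability T R) (E : (set T)^nat) :
  (forall n, measurable (E n)) -> nonincreasing_seq E ->
  P (E n) @[n --> \oo] --> P (\bigcap_n E n).
Proof.
move=> mE dE; apply: nonincreasing_cvg_mu => //.
  by rewrite (le_lt_trans (probability_le1 _ _)) ?ltry.
exact: bigcapT_measurable.
Qed.

Lemma same_law_bounded_event d (T : measurableType d) (R : realType) (P :
  probability T R)
    (U V : R -> T -> R) t B c :
  (forall u, measurable_fun setT (U u)) -> (forall u, measurable_fun setT (V u)) ->
  right_continuous_paths U -> right_continuous_paths V ->
  same_law P U V -> 0 <= t -> measurable B ->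
  P (bounded_event U t B c) = P (bounded_event V t B c).
Proof.
move=> mU mV rU rV UV t0 mB; rewrite !bounded_event_bigcap//.
have UVn n : P (grid_event U t B c n) = P (grid_event V t B c n).
  pose s (i : 'I_(2 ^ n).+1) := grid t n i.
  (* The grid event is a rectangle in the values on the grid; [B] constrains only the last of them,
     at time [t]. *)
  pose C (i : 'I_(2 ^ n).+1) := [set x : R | (x%:E <= c)%E] `&`
    (if i == ord_max then B else setT).
  have CE (W : R -> T -> R) : grid_event W t B c n =
      \bigcap_(i in [set: 'I_(2 ^ n).+1]) (W (s i) @^-1` C i).
    apply/seteqP; split=> [w [Bw H] i _|w H].
      split; first by apply: H; rewrite -ltnS.
      by case: ifP => // /eqP ->; rewrite /s grid_last.
    split; last by move=> k; rewrite -ltnS => kn; have [] := H (Ordinal kn) Logic.I.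
    by have [_] := H ord_max Logic.I; rewrite eqxx /s grid_last.
  rewrite !CE; apply: UV => i; first exact: grid_ge0.
  by apply: measurableI; [exact: measurable_le_ereal|case: ifP].
have cU := @cvg_probability_bigcap _ _ _ P (grid_event U t B c) (fun n =>
  measurable_grid_event _ _ _ mU mB)
  (@grid_event_nonincreasing _ _ _ _ _ _).
have cV := @cvg_probability_bigcap _ _ _ P (grid_event V t B c) (fun n =>
  measurable_grid_event _ _ _ mV mB)
  (@grid_event_nonincreasing _ _ _ _ _ _).
rewrite -(cvg_lim _ cU)// -(cvg_lim _ cV)//.
by congr (limn _); apply/funext => n; exact: UVn.
Qed.

(** * Independence of the past and of the shifted process *)

Definition shift T (R : realType) (X : R -> T -> R) (s : R) : R -> T -> R :=
  fun u w => X (s + u) w - X s w.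

Definition increment T (R : realType) (U : R -> T -> R) (t : R) (n : nat)
    (i : 'I_(2 ^ n)) : T -> R :=
  fun w => U (grid t n i.+1) w - U (grid t n i) w.

Lemma gridS (R : realType) (t : R) n k : grid t n k.+1 = grid t n k + grid t n 1.
Proof. by rewrite /grid -addn1 natrD mulrDl mulrDr. Qed.

Lemma sum_increment T (R : realType) (U : R -> T -> R) t n k w :
  U 0 w = 0 -> (k <= 2 ^ n)%N ->
  \sum_(i < 2 ^ n | (i < k)%N) increment U t i w = U (grid t n k) w.
Proof.
move=> U0 kn.
rewrite -(big_ord_widen _ (fun i => U (grid t n i.+1) w - U (grid t n i) w) kn).
elim: k {kn} => [|k IH]; first by rewrite big_ord0 grid0.
by rewrite big_ord_recr/= IH addrC subrK.
Qed.

(** A grid event read off the increments, whose partial sums are the path values on the grid.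
    Independence is given for increments, not for values. *)
Definition partial_sum_event (R : realType) n (B : set R) (c : \bar R) :
    set (g_sigma_algebraType (@rectangles R n)) :=
  [set v | B (\sum_(i < n | (i < n)%N) v i) /\
    forall k, (k <= n)%N -> ((\sum_(i < n | (i < k)%N) v i)%:E <= c)%E].

Lemma measurable_partial_sum_event (R : realType) n (B : set R) c :
  measurable B -> measurable (@partial_sum_event R n B c).
Proof.
move=> mB.
have ms k C : measurable C -> measurable
    [set v : g_sigma_algebraType (@rectangles R n) | C (\sum_(i < n | (i < k)%N) v
      i)].
  move=> mC.
  have mf : measurable_fun setT (fun v : g_sigma_algebraType (@rectangles R n) =>
      \sum_(i < n) (if (i < k)%N then v i else 0)).
    apply: measurable_sum => i; case: (i < k)%N; first exact: measurable_coord.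
    exact: measurable_cst.
  have := mf measurableT C mC; rewrite setTI.
  rewrite (_ : _ @^-1` C = [set v | C (\sum_(i < n | (i < k)%N) v i)])//.
  by apply/funext => v /=; congr (C _); rewrite [RHS]big_mkcond.
rewrite [X in measurable X](_ : _ =
  [set v : g_sigma_algebraType (@rectangles R n) | B (\sum_(i < n | (i < n)%N) v i)]
    `&`
  \bigcap_(k in [set k | (k <= n)%N])
  [set v : g_sigma_algebraType (@rectangles R n) | ((\sum_(i < n | (i < k)%N) v
    i)%:E <= c)%E]).
  apply: measurableI; first exact: ms.
  by apply: bigcap_measurableType => k _; exact: (ms k _ (measurable_le_ereal c)).
by apply/seteqP; split=> w [Bw H]; split.
Qed.

Lemma grid_event_increment T (R : realType) (U : R -> T -> R) t n B c :
  (forall w, U 0 w = 0) ->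
  grid_event U t B c n =
  [set w | partial_sum_event B c (fun i : 'I_(2 ^ n) => increment U t i w)].
Proof.
move=> U0; apply/seteqP; split=> w [].
  move=> Bw H; split; first by rewrite sum_increment// grid_last.
  by move=> k kn; rewrite sum_increment//; exact: H.
rewrite sum_increment// grid_last => Bw H; split=> // k kn.
by have := H k kn; rewrite sum_increment.
Qed.

(** Joins past and future increments into a single family, the form in which independence of
    increments can be applied. *)
Lemma setI_rect_split T (R : realType) m n (U : 'I_m -> T -> R) (V : 'I_n -> T -> R)
    (B : 'I_m -> set R) (C : 'I_n -> set R) (Y : 'I_(m + n) -> T -> R) :
  (forall i, Y (lshift n i) = U i) -> (forall j, Y (rshift m j) = V j) ->
  [set w | forall i, B i (U i w)] `&` [set w | forall i, C i (V i w)] =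
  \bigcap_(i in [set: 'I_(m + n)])
    (Y i @^-1` (match fintype.split i with inl a => B a | inr b => C b end)).
Proof.
move=> YU YV; apply/seteqP; split=> [w [HB HC] i _|w H]; last first.
  split=> i.
    by have := H (lshift n i) Logic.I; rewrite (unsplitK (inl i)) /= YU.
  by have := H (rshift m i) Logic.I; rewrite (unsplitK (inr i)) /= YV.
case: (split_ordP i) => [a ->|b ->].
  by rewrite /preimage/= YU; exact: HB.
by rewrite /preimage/= YV; exact: HC.
Qed.

Section levy.
Context d (T : measurableType d) (R : realType) (P : probability T R)
  (X : R -> {RV P >-> R}) (HX : levy_process X).

Lemma shift0 s w : shift X s 0 w = 0.
Proof. by rewrite /shift addr0 subrr. Qed.

Lemma measurable_levy u : measurable_fun setT (X u).
Proof. by []. Qed.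

Lemma measurable_shift s u : measurable_fun setT (shift X s u).
Proof. exact: measurable_funB. Qed.

Lemma right_continuous_levy : right_continuous_paths X.
Proof. by move=> w u u0; have [H _] := levy_cadlag HX w; exact: H. Qed.

Lemma right_continuous_shift s : 0 <= s -> right_continuous_paths (shift X s).
Proof.
move=> s0 w u u0; apply: cvgB; last exact: cvg_cst.
apply: (@cvg_comp _ _ _ (fun x => s + x) (fun x => X x w) _ (s + u)^'+).
  move=> A [e /= e0 H]; exists e => //= v uv ltuv; apply: H => /=.
    by rewrite opprD addrACA subrr add0r.
  by rewrite ltrD2l.
by apply: right_continuous_levy; rewrite addr_ge0.
Qed.

Lemma measurable_increment (U : R -> T -> R) t n (i : 'I_(2 ^ n)) :
  (forall u, measurable_fun setT (U u)) -> measurable_fun setT (increment U t i : T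
    -> R).
Proof. by move=> mU; exact: measurable_funB. Qed.

Lemma increment_rect t n (B : 'I_(2 ^ n) -> set R) : 0 <= t ->
  (forall i, measurable (B i)) ->
  P [set w | forall i, B i (increment X t i w)] =
  (\prod_(i < 2 ^ n) P (increment X t i @^-1` B i))%E.
Proof.
move=> t0 mB.
have g0 : 0 <= grid t n 0 by rewrite grid0.
have gnd : nondecreasing_seq (grid t n) by move=> i j ij; exact: grid_le.
have := levy_independent HX (n := (2 ^ n)%N) g0 gnd mB; rewrite /increment => <-.
by congr (P _); apply/seteqP; split=> w H i; [move=> _;
  exact: H|exact: (H i Logic.I)].
Qed.

Lemma increment_shift_law s t n (i : 'I_(2 ^ n)) B : 0 <= s -> 0 <= t -> measurable
  B ->
  P (increment (shift X s) t i @^-1` B) = P (increment X t i @^-1` B).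
Proof.
move=> s0 t0 mB.
have E : increment (shift X s) t i @^-1` B =
    [set w | B (X (s + grid t n i + grid t n 1) w - X (s + grid t n i) w)].
  by apply/funext => w; rewrite /preimage/= /increment /shift opprB addrA subrK
    -addrA -gridS.
rewrite E (levy_stationary HX (addr_ge0 s0 (grid_ge0 n i t0)) (grid_ge0 n 1 t0) mB).
rewrite -(levy_stationary HX (grid_ge0 n i t0) (grid_ge0 n 1 t0) mB).
by congr (P _); apply/funext => w; rewrite -gridS.
Qed.

Lemma grid_event_indep s t n B c C c' : 0 <= s -> 0 <= t -> measurable B ->
  measurable C ->
  P (grid_event X s B c n `&` grid_event (shift X s) t C c' n) =
  (P (grid_event X s B c n) * P (grid_event X t C c' n))%E.
Proof.
move=> s0 t0 mB mC.
rewrite !grid_event_increment; [|exact: (levy0 HX)|exact: shift0|exact: (levy0 HX)].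
apply: (@eq_rectangles_indep _ _ _ P _ _ (@increment _ R X s n) (@increment _ R
  (shift X s) t n)
  (@increment _ R X t n)); last 2 first.
- exact: measurable_partial_sum_event.
- exact: measurable_partial_sum_event.
- by move=> i; apply: measurable_increment => u; exact: measurable_levy.
- by move=> i; apply: measurable_increment => u; exact: measurable_shift.
- by move=> i; apply: measurable_increment => u; exact: measurable_levy.
move=> D E mD mE; rewrite !increment_rect//.
(* The grid of [0, s] followed by that of [s, s + t]. The two meet at index [2 ^ n], where both give
   [s], so no spurious increment is inserted. *)
pose tau i := if (i <= 2 ^ n)%N then grid s n i else s + grid t n (i - 2 ^ n).
pose Y (i : 'I_(2 ^ n + 2 ^ n)) w := X (tau i.+1) w - X (tau i) w.
have tau_nd : nondecreasing_seq tau.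
  apply/nondecreasing_seqP => k; rewrite /tau; have [k1|k1] := ltnP k (2 ^ n).
    by rewrite (ltnW k1) grid_le.
  have [k2|k2] := leqP k (2 ^ n).
    have -> : k = (2 ^ n)%N by apply/eqP; rewrite eqn_leq k2.
    by rewrite grid_last lerDl grid_ge0.
  by rewrite lerD2l grid_le// leq_sub2r.
have tau_r j : tau (2 ^ n + j)%N = s + grid t n j.
  rewrite /tau; case: leqP => k1; last by rewrite addKn.
  by move: k1; rewrite -{2}[(2 ^ n)%N]addn0 leq_add2l leqn0 => /eqP ->;
    rewrite addn0 grid_last grid0 addr0.
rewrite (@setI_rect_split _ _ _ _ _ _ D E Y); last 2 first.
- move=> i; apply/funext => w; rewrite /Y /increment /tau/=.
  by rewrite ltn_ord ltnW.
- move=> j; apply/funext => w; rewrite /Y /increment /= -addnS !tau_r.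
  by rewrite /shift opprB addrA subrK.
have tau0 : 0 <= tau 0%N by rewrite /tau leq0n grid0.
rewrite (levy_independent HX tau0 tau_nd); last by move=> i; case: fintype.split.
rewrite big_split_ord/=; congr (_ * _)%E; apply: eq_bigr => i _.
  rewrite (unsplitK (inl i))/=; congr (P _); apply/funext => w.
  by rewrite /preimage /= /increment /tau/= ltn_ord ltnW.
rewrite (unsplitK (inr i))/= -(increment_shift_law i s0 t0 (mE i)); congr (P _);
  apply/funext => w.
by rewrite /preimage /= -addnS !tau_r /increment /shift opprB addrA subrK.
Qed.

(** The simple Markov property at a deterministic time, for events constraining the whole path: the
    factorization on grids passes to the limit along decreasing intersections. *)
Lemma bounded_event_indep s t B c C c' :
  0 <= s -> 0 <= t -> measurable B -> measurable C ->
  P (bounded_event X s B c `&` bounded_event (shift X s) t C c') =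
  (P (bounded_event X s B c) * P (bounded_event X t C c'))%E.
Proof.
move=> s0 t0 mB mC.
have mX := measurable_levy; have mS := measurable_shift s.
have rX := right_continuous_levy; have rS := right_continuous_shift s0.
rewrite !bounded_event_bigcap//.
have Pfin E : measurable E -> P E \is a fin_num by move=> mE; rewrite fin_num_measure.
have c1 := @cvg_probability_bigcap _ _ _ P _ (fun n => @measurable_grid_event _ _ _
  X s B c n mX mB)
  (@grid_event_nonincreasing _ _ _ _ _ _).
have c2 := @cvg_probability_bigcap _ _ _ P _ (fun n => @measurable_grid_event _ _ _
  X t C c' n mX mC)
  (@grid_event_nonincreasing _ _ _ _ _ _).
have c3 := @cvg_probability_bigcap _ _ _ P
  (fun n => grid_event X s B c n `&` grid_event (shift X s) t C c' n)
  (fun n => measurableI _ _ (@measurable_grid_event _ _ _ X s B c n mX mB)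
    (@measurable_grid_event _ _ _ (shift X s) t C c' n mS mC)).
rewrite -bigcapI -(cvg_lim _ (c3 _))//; last first.
  move=> m n mn; rewrite subsetEset; apply: setISS.
    by have := @grid_event_nonincreasing _ _ X s B c _ _ mn; rewrite subsetEset.
  by have := @grid_event_nonincreasing _ _ (shift X s) t C c' _ _ mn;
    rewrite subsetEset.
under eq_fun do rewrite grid_event_indep//.
apply/cvg_lim => //; apply: cvgeM => //.
by apply: mule_def_fin; apply: Pfin; apply: bigcapT_measurable => n;
  exact: measurable_grid_event.
Qed.

Lemma shift_bounded_event s t C c' : 0 <= s -> 0 <= t -> measurable C ->
  P (bounded_event (shift X s) t C c') = P (bounded_event X t C c').
Proof.
move=> s0 t0 mC.
have := @bounded_event_indep s t setT +oo%E C c' s0 t0 measurableT mC.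
(* With a sure event for the past, independence reduces to equality in law. *)
have -> : bounded_event X s setT +oo%E = setT.
  by apply/seteqP; split=> w // _; split=> // u _; rewrite leey.
by rewrite setTI probability_setT mul1e.
Qed.
End levy.

(** * Strict stability and signs of the increments *)

Lemma eq_law_laplace d (T : measurableType d) (R : realType) (P : probability T R)
    (Y Z : {mfun T >-> R}) (q : R) :
  (forall B, measurable B -> P (Y @^-1` B) = P (Z @^-1` B)) ->
  ('E_P[(fun w => expR (- (q * Y w)))] = 'E_P[(fun w => expR (- (q * Z w)))])%E.
Proof.
move=> YZ; rewrite !unlock.
pose f (y : R) := (expR (- (q * y)))%:E.
have mf : measurable_fun setT f.
  apply/measurable_EFinP; apply: measurableT_comp => //.
  by apply: measurableT_comp => //; exact: measurable_funM.
have f0 y : (0 <= f y)%E by rewrite lee_fin expR_ge0.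
rewrite -(@ge0_integral_distribution _ _ T R R P Y f)//.
rewrite -(@ge0_integral_distribution _ _ T R R P Z f)//.
by apply: eq_measure_integral => A mA _; exact: YZ.
Qed.

Section stable.
Context d (T : measurableType d) (R : realType) (P : probability T R)
  (alpha : R) (X : R -> {RV P >-> R}).
Context (alpha_gt1 : 1 < alpha)
  (X_stable : stable_process alpha X)
  (X_laplace : forall t q : R, 0 < t -> 0 <= q ->
       ('E_P[(fun w => expR (- (q * X t w))%R)] = (expR (t * q `^ alpha)%R)%:E)%E).

Let HX : levy_process X. Proof. by case: X_stable. Qed.
Let a0 : 0 < alpha. Proof. exact: lt_trans alpha_gt1. Qed.

(* The Laplace transforms at q = 1 force the drift b to vanish. *)
Lemma strict_scaling a : 0 < a ->
  same_law P (fun t w => X (a * t) w) (fun t w => a `^ alpha^-1 * X t w).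
Proof.
move=> ap; have [_ /(_ a ap)[b Hb]] := X_stable.
suff b0 : b = 0.
  have -> // : (fun t w => a `^ alpha^-1 * X t w) =
      (fun t w => a `^ alpha^-1 * X t w + b * t).
  by apply/funext => t; apply/funext => w; rewrite b0 mul0r addr0.
set l := a `^ alpha^-1 in Hb *.
have l0 : 0 <= l by exact: powR_ge0.
have mZ : measurable_fun setT (fun w => l * X 1 w + b).
  by apply: measurable_funD => //; exact: measurable_funM.
pose Zm := isMeasurableFun.Build _ _ _ _ _ mZ.
pose Z : {mfun T >-> R} := HB.pack (fun w => l * X 1 w + b) Zm.
have XZ B : measurable B -> P (X a @^-1` B) = P (Z @^-1` B).
  move=> mB; have := Hb 1%N (fun=> 1) (fun=> B) (fun=> ler01) (fun=> mB).
  have big1 (V : T -> R) : \bigcap_(i in [set: 'I_1]) (V @^-1` B) = V @^-1` B.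
    by apply/seteqP; split=> [w /(_ ord0 Logic.I)|w Vw i].
  by rewrite !big1 !mulr1.
have := eq_law_laplace 1 XZ; rewrite X_laplace//.
have -> : ('E_P[(fun w => expR (- (1 * Z w)))] =
    (expR (- b))%:E * 'E_P[(fun w => expR (- (l * X 1 w)))])%E.
  rewrite !unlock -ge0_integralZl_EFin//.
  - by apply: eq_integral => w _; rewrite -EFinM -expRD /= mul1r opprD addrC.
  - apply/measurable_EFinP; apply: measurableT_comp => //.
    by apply: measurableT_comp => //; exact: measurable_funM.
(* Here l^alpha = a, so the comparison of transforms reads e^a = e^(-b) e^a. *)
have lq : 'E_P[(fun w => expR (- (l * X 1 w)))]%E = (expR a)%:E.
  by rewrite X_laplace// mul1r -powRrM mulVf ?lt0r_neq0// powRr1 ?ltW.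
rewrite lq powR1 mulr1.
rewrite -EFinM -expRD => -[H]; have := expR_inj H; lra.
Qed.

(** [Num.max 0 y] is the least barrier that a path from 0 to y can respect. The same [e] relaxes
    target and barrier, so that slacks simply add when moves are joined. *)
Definition tight_event (t y e : R) : set T :=
  bounded_event X t `]y - e, y + e[%classic (Num.max 0 y + e)%:E.

Definition tight (t y e : R) : Prop := (0 < P (tight_event t y e))%E.

Lemma tight_scale a t y e : 0 < a -> 0 <= t -> tight t y e ->
  tight (a * t) (a `^ alpha^-1 * y) (a `^ alpha^-1 * e).
Proof.
move=> ap t0; rewrite /tight /tight_event; set l := a `^ alpha^-1.
have l0 : 0 < l by exact: powR_gt0.
have mX := measurable_levy; have rX := right_continuous_levy HX.
have := @same_law_bounded_event _ _ _ P (fun t w => X (a * t) w) (fun t w => l * X t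
  w) t
  `]l * y - l * e, l * y + l * e[%classic (Num.max 0 (l * y) + l * e)%:E.
move=> /(_ _ _ _ _ (strict_scaling ap) t0 (measurable_itv _)) E.
have -> : bounded_event X (a * t) `]l * y - l * e, l * y + l * e[%classic
     (Num.max 0 (l * y) + l * e)%:E = bounded_event (fun t w => X (a * t) w) t
     `]l * y - l * e, l * y + l * e[%classic (Num.max 0 (l * y) + l * e)%:E.
  apply/seteqP; split=> w [Bw H]; split => // u /andP[u0 ut].
    by apply: H; rewrite mulr_ge0 ?(ltW ap)//= ler_pM2l.
  have -> : u = a * (u / a) by field; exact: lt0r_neq0.
  by apply: H; rewrite divr_ge0 ?(ltW ap)//= ler_pdivrMr// mulrC.
rewrite E//.
- have -> : Num.max 0 (l * y) + l * e = l * (Num.max 0 y + e).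
    by rewrite mulrDr maxr_pMr ?(ltW l0)// mulr0.
  rewrite -mulrBr -mulrDr; congr (0 < P _)%E; apply/seteqP.
  split=> w [H1 H2]; split; (do ?[move=> u /H2; rewrite !lee_fin ler_pM2l//]);
    by move: H1; rewrite /= !in_itv/= !ltr_pM2l.
- by move=> u; exact: measurable_funM.
- move=> w u u0; apply: (@cvg_comp _ _ _ (fun x => a * x) (fun x => X x w) _ (a *
    u)^'+).
    move=> A [r /= r0 H]; exists (r / a); first exact: divr_gt0.
    move=> v /= uv ltuv; apply: H => /=; last by rewrite ltr_pM2l.
    by rewrite -mulrBr normrM gtr0_norm// mulrC -ltr_pdivlMr.
  by apply: rX; rewrite mulr_ge0// ltW.
- by move=> w u u0; apply: cvgM; [exact: cvg_cst|exact: rX].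
Qed.
End stable.

Lemma measure_gt0S d (T : measurableType d) (R : realType) (P : probability T R) (A
  B : set T) :
  measurable A -> measurable B -> A `<=` B -> (0 < P A)%E -> (0 < P B)%E.
Proof. by move=> mA mB AB /lt_le_trans; apply; rewrite le_measure// inE. Qed.

Lemma measure_gt0_bigcup d (T : measurableType d) (R : realType) (P : probability T R)
    (A : set T) (F : (set T)^nat) :
  measurable A -> (forall n, measurable (F n)) -> A `<=` \bigcup_n F n ->
  (0 < P A)%E -> exists n, (0 < P (F n))%E.
Proof.
move=> mA mF AF PA; apply: contrapT => /forallNP H.
have : P (\bigcup_n F n) = 0%E.
  apply: measure_negligible; first exact: bigcupT_measurable.
  apply: negligible_bigcup => k; apply/negligibleP => //.
  by apply/eqP; rewrite eq_le measure_ge0 andbT leNgt; apply/negP/H.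
apply/eqP; rewrite gt_eqF//.
by apply: (measure_gt0S mA _ AF PA); exact: bigcupT_measurable.
Qed.

(** Expanding and dividing by q gives k (1 - q m / 4) <= m / 4; since q m <= 1 the left side is at
    least 3 k / 4, although k >= m. *)
Lemma small_slope_contra (R : realFieldType) (q m k : R) :
  0 < q -> m <= k -> 0 < m -> q * m <= 1 ->
  (1 - q * (m / 4)) * (1 + q * k) <= 1 -> False.
Proof.
move=> q0 mk m0 qm H.
have H1 : q * (k * (1 - q * m / 4)) <= q * (m / 4).
  by rewrite -subr_ge0; move: H; rewrite -subr_ge0; congr (0 <= _); field.
rewrite ler_pM2l// in H1.
have k0 : 0 < k by lra.
have : k * (3 / 4) <= k * (1 - q * m / 4) by rewrite ler_pM2l//; lra.
lra.
Qed.

Section sign.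
Context d (T : measurableType d) (R : realType) (P : probability T R)
  (alpha : R) (Y : {RV P >-> R}).
Context (alpha_gt1 : 1 < alpha)
  (Y_laplace : forall q : R, 0 <= q ->
       ('E_P[(fun w => expR (- (q * Y w))%R)] = (expR (q `^ alpha)%R)%:E)%E).

Let mlt r : measurable [set w | Y w < r].
Proof.
rewrite (_ : [set _ | _] = Y @^-1` `]-oo, r[%classic); first exact: measurable_funPTI.
by apply/seteqP; split=> w /=; rewrite in_itv.
Qed.

Let mgt r : measurable [set w | r < Y w].
Proof.
rewrite (_ : [set _ | _] = Y @^-1` `]r, +oo[%classic); first exact: measurable_funPTI.
by apply/seteqP; split=> w /=; rewrite in_itv/= andbT.
Qed.

Let mexp q : measurable_fun setT (fun w => (expR (- (q * Y w)))%:E).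
Proof.
apply/measurable_EFinP; apply: measurableT_comp => //.
by apply: measurableT_comp => //; exact: measurable_funM.
Qed.

(** If Y >= 0 almost surely then E e^(-Y) <= 1, whereas it equals e. *)
Lemma charges_negative : exists2 eta : R,
  0 < eta & (0 < P [set w | (Y w < - eta)%R])%E.
Proof.
have P0 : (0 < P [set w | (Y w < 0)%R])%E.
  rewrite lt0e measure_ge0 andbT; apply/eqP => P0.
  have : ('E_P[(fun w => expR (- (1 * Y w))%R)] <= 1%:E)%E.
    rewrite unlock -(@probability_setT _ _ _ P) -[leRHS]mul1e -integral_cst//.
    apply: ae_ge0_le_integral => //.
    exists [set w | Y w < 0]; split => // w /= /not_implyP[_].
    by rewrite lee_fin mul1r -expR0 ler_expR oppr_le0 => /negP; rewrite -ltNge.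
  rewrite Y_laplace// powR1 lee_fin; apply/negP; rewrite -ltNge.
  by rewrite expR_gt1.
have [|n Hn] := measure_gt0_bigcup (mlt 0) (fun n => mlt (- n.+1%:R^-1)) _ P0.
  move=> w /= Yw; have Yp : 0 < - Y w by rewrite oppr_gt0.
  have [n nY] := ltr_add_invr Yp.
  by exists n => //=; move: nY; rewrite add0r ltrNr.
by exists n.+1%:R^-1.
Qed.

(* If Y <= 0 almost surely, E e^(-qY) >= 1 + q eta p with eta p > 0, which is
   incompatible with e^(q^alpha) = 1 + o(q). *)
Lemma charges_positive : exists2 eta : R, 0 < eta & (0 < P [set w | (eta < Y w)%R])%E.
Proof.
suff P0 : (0 < P [set w | (0 < Y w)%R])%E.
  have [|n Hn] := measure_gt0_bigcup (mgt 0) (fun n => mgt (n.+1%:R^-1)) _ P0.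
    move=> w /= Yw; have [n nY] := ltr_add_invr Yw.
    by exists n => //=; move: nY; rewrite add0r.
  by exists n.+1%:R^-1.
rewrite lt0e measure_ge0 andbT; apply/eqP => P0.
have [eta eta0 Peta] := charges_negative.
set D := [set w | Y w < - eta] in Peta.
have mD : measurable D by exact: mlt.
pose p := fine (P D).
have pE : P D = p%:E by rewrite fineK// fin_num_measure.
have p0 : 0 < p by rewrite -lte_fin -pE.
(* Integrates the pointwise bound e^(-q Y) >= 1 - q Y >= 1 + q eta 1_D, valid wherever Y <= 0. *)
have key q : 0 < q -> 1 + q * eta * p <= expR (q `^ alpha).
  move=> q0; rewrite -lee_fin -Y_laplace ?(ltW q0)// unlock.
  have -> : (1 + q * eta * p)%:E =
      (\int[P]_w ((cst 1%:E w) + (q * eta)%:E * (\1_D w)%:E))%E.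
    rewrite ge0_integralD//; last 2 first.
    - by move=> w _; rewrite mule_ge0// lee_fin ?mulr_ge0// ltW.
    - by apply/measurable_EFinP; apply: measurable_funM => //;
        exact: measurable_indic.
    have -> : (\int[P]_w cst 1%:E w = 1%:E)%E.
      by rewrite integral_cst// mul1e; exact: probability_setT.
    rewrite ge0_integralZl_EFin//; last 2 first.
    - exact/measurable_EFinP.
    - by rewrite mulr_ge0// ltW.
    have -> : (\int[P]_w (\1_D w)%:E = p%:E)%E.
      by rewrite integral_indic// setIT; exact: pE.
    by rewrite -EFinM -EFinD.
  apply: ae_ge0_le_integral => //.
  - by move=> w _; rewrite adde_ge0// mule_ge0// lee_fin ?mulr_ge0// ltW.
  - apply: emeasurable_funD => //; apply/measurable_EFinP.
    by apply: measurable_funM => //; exact: measurable_indic.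
  exists [set w | 0 < Y w]; split => // w /= /not_implyP[_] /negP.
  rewrite -ltNge -EFinM -EFinD lte_fin => Hw; rewrite ltNge; apply/negP => Yw.
  move: Hw; rewrite ltNge => /negP; apply.
  apply: le_trans (expR_ge1Dx _); rewrite lerD2l -mulrN -mulrA ler_pM2l//.
  rewrite indicE; case: (boolP (w \in D)) => [|_].
    by rewrite inE /D/= mulr1 => /ltW; rewrite lerNr.
  by rewrite mulr0 oppr_ge0.
pose m := Num.min 1 (eta * p).
have m0 : 0 < m by rewrite lt_min ltr01 mulr_gt0.
have m1 : m <= 1 by rewrite ge_min lexx.
have mep : m <= eta * p by rewrite ge_min lexx orbT.
have am1 : 0 < alpha - 1 by rewrite subr_gt0.
(* Chosen so that q^alpha = q m / 4, whose slope is below eta p. Capping [m] by 1 gives q <= 1,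
   hence q m <= 1. *)
pose q := (m / 4) `^ (alpha - 1)^-1.
have q0 : 0 < q by apply: powR_gt0; rewrite divr_gt0.
have m4 : 0 <= m / 4 by lra.
have q1 : q <= 1.
  have -> : 1 = 1 `^ (alpha - 1)^-1 :> R by rewrite powR1.
  by apply: ge0_ler_powR; rewrite ?nnegrE ?invr_ge0 ?(ltW am1)//; lra.
have qa : q `^ alpha = q * (m / 4).
  have -> : q `^ alpha = q `^ (1 + (alpha - 1)) by rewrite addrC subrK.
  rewrite powRD; last by rewrite (gt_eqF q0) implybT.
  rewrite powRr1 ?(ltW q0)//; congr (_ * _).
  by rewrite -powRrM mulVf ?lt0r_neq0// powRr1.
have := key q q0; rewrite qa => H1.
(* The bound 1 - v <= e^(-v) turns into (1 - v) e^v <= 1, an upper estimate for the exponential in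
   [key]. *)
have := expR_ge1Dx (- (q * (m / 4))); rewrite expRN => H2.
have e0 := expR_gt0 (q * (m / 4)).
set e := expR _ in H1 H2 e0.
have H3 : (1 - q * (m / 4)) * e <= 1 by rewrite -ler_pdivlMr// div1r.
have qm : q * m <= 1 by rewrite -[leRHS]mulr1 ler_pM// ltW.
have H4 : (1 - q * (m / 4)) * (1 + q * (eta * p)) <= 1.
  rewrite mulrA; apply: le_trans H3; apply: ler_wpM2l => //.
  by rewrite subr_ge0 mulrA ler_pdivrMr// mul1r (le_trans qm)// ler1n.
exact: (small_slope_contra q0 mep m0 qm H4).
Qed.
End sign.

(** * Tight moves *)

Section tight.
Context d (T : measurableType d) (R : realType) (P : probability T R)
  (X : R -> {RV P >-> R}) (HX : levy_process X).

Lemma measurable_tight_event t y e : 0 <= t -> measurable (tight_event X t y e).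
Proof.
move=> t0; apply: measurable_bounded_event => //; exact: right_continuous_levy.
Qed.

Lemma tight_mono t y e e' : 0 <= t -> e <= e' -> tight X t y e -> tight X t y e'.
Proof.
move=> t0 ee; apply: measure_gt0S; try exact: measurable_tight_event.
move=> w [/= yw H]; split.
  by move: yw; rewrite /= !in_itv/= => /andP[]; lra.
by move=> u /H /le_trans; apply; rewrite lee_fin lerD2l.
Qed.

(* The sign condition puts the downward move first, so that the intermediate
   position does not overshoot max(0, y + z). *)
Lemma tight_add s t y z e e' : 0 <= s -> 0 <= t -> 0 <= e -> 0 <= e' ->
  y <= 0 \/ 0 <= z ->
  tight X s y e -> tight X t z e' -> tight X (s + t) (y + z) (e + e').
Proof.
move=> s0 t0 e0 e'0 yz ty tz.
have ms := right_continuous_shift HX s0.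
apply: (measure_gt0S (A := tight_event X s y e `&`
  bounded_event (shift X s) t `]z - e', z + e'[%classic (Num.max 0 z + e')%:E)).
- apply: measurableI; first exact: measurable_tight_event.
  by apply: measurable_bounded_event => // u; exact: measurable_shift.
- by apply: measurable_tight_event; exact: addr_ge0.
- move=> w [[/= yw Hy] [/= zw Hz]]; split.
    by move: yw zw; rewrite /= /shift !in_itv/= => /andP[? ?] /andP[? ?];
      apply/andP; split; lra.
  move=> u /andP[u0 ust]; rewrite lee_fin.
  (* The barriers of the two legs, seen from 0, must lie below that of the sum. Both inequalities
     fail for y > 0 > z. *)
  have my : Num.max 0 y <= Num.max 0 (y + z).
    by case: yz => yz; case: (leP 0 y) => ?; case: (leP 0 (y + z)) => ?; lra.
  have mz : y + Num.max 0 z <= Num.max 0 (y + z).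
    by case: yz => yz; case: (leP 0 z) => ?; case: (leP 0 (y + z)) => ?; lra.
  have [us|su] := leP u s.
    have := Hy u; rewrite u0 us lee_fin => /(_ isT); lra.
  have := Hz (u - s); rewrite /shift (addrC s) subrK lee_fin subr_ge0 (ltW su)
    lerBlDl ust => /(_ isT).
  by move: yw; rewrite in_itv/= => /andP[? ?]; lra.
rewrite /tight_event bounded_event_indep//.
by apply: mule_gt0; [exact: ty|exact: tz].
Qed.

(** Repeating one move always respects the sign condition of [tight_add]. The slack is multiplied by
    the number of moves. *)
Lemma tight_iter n s y e : 0 <= s -> 0 <= e -> tight X s y e ->
  tight X (s * n.+1%:R) (y * n.+1%:R) (e * n.+1%:R).
Proof.
move=> s0 e0 ty; elim: n => [|n IH]; first by rewrite !mulr1.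
have mulS (x : R) : x * n.+2%:R = x + x * n.+1%:R.
  by rewrite -(natr1 n.+1) mulrDr mulr1 addrC.
rewrite !mulS; apply: tight_add => //; try by rewrite mulr_ge0.
have [y0|y0] := leP y 0; first by left.
by right; rewrite mulr_ge0// ltW.
Qed.
End tight.

(** * Near-maxima and the existence of upward and downward tight moves *)

Lemma cadlag_bounded (R : realType) (f : R -> R) (L : R) : cadlag f ->
  exists K, forall u, 0 <= u <= L -> f u <= K.
Proof.
move=> [fr fl].
have /compact_near_coveringP cpt := @segment_compact R 0 L.
(* A local bound phrased as holding for all large [K], so that compactness yields one [K] for the
   segment. It comes from the right and left limits; left of 0 there is nothing to bound. *)
have loc x : `[0, L]%classic x -> \forall x' \near x & K \near +oo,
  0 <= x' -> f x' <= K.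
  rewrite /= in_itv/= => /andP[x0 xL].
  have [K1 HK1] : exists K1, \forall x' \near x, x < x' -> f x' <= K1.
    exists (f x + 1); have := fr x x0 => fx.
    have : \forall x' \near x^'+, f x' <= f x + 1.
      by apply: (cvgr_le (f x) fx); rewrite ltrDl.
    by rewrite near_withinE.
  have [K2 HK2] : exists K2, \forall x' \near x, 0 <= x' -> x' < x -> f x' <= K2.
    move: x0; rewrite le_eqVlt => /predU1P[<-|x0].
      by exists 0; near=> x' => x'0; rewrite ltNge x'0.
    have /cvg_ex[l fxl] := fl x x0.
    exists (l + 1).
    have : \forall x' \near x^'-, f x' <= l + 1.
      by apply: (cvgr_le l fxl); rewrite ltrDl.
    by rewrite near_withinE; apply: filterS => x' H _.
  near=> x' K => /= x'0.
  have [xx'|xx'|<-] := ltgtP x x'; last first.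
  - by near: K; apply: nbhs_pinfty_ge; exact: num_real.
  - apply: (@le_trans _ _ K2); last by near: K; apply: nbhs_pinfty_ge;
      exact: num_real.
    by move: x'0 xx'; near: x'; exact: HK2.
  - apply: (@le_trans _ _ K1); last by near: K; apply: nbhs_pinfty_ge;
      exact: num_real.
    by move: xx'; near: x'; exact: HK1.
have [K [_ HK]] := cpt _ _ _ _ loc.
have KK : K < K + 1 by rewrite ltrDl.
exists (K + 1) => u uL; apply: (HK _ KK u); last by case/andP: uL.
by rewrite /= in_itv.
Unshelve. all: by end_near. Qed.

(** A cadlag path may approach its supremum only as a left limit, hence the loss [e]. If every grid
    value were at most the supremum minus [e], [dyadic_le] would extend this to all times. *)
Lemma near_argmax (R : realType) (f : R -> R) (L e : R) : cadlag f -> 0 <= L -> 0 <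
  e ->
  exists M n k, [/\ (k <= 2 ^ n)%N, forall u, 0 <= u <= L -> f u <= M &
    M - e < f (grid L n k)].
Proof.
move=> cf L0 e0; have [K HK] := cadlag_bounded L cf.
pose A := [set f u | u in [set u | 0 <= u <= L]].
have hsA : has_sup A.
  split; first by exists (f 0), 0 => //=; rewrite lexx.
  by exists K => _ [u /HK ? <-].
have ubA u : 0 <= u <= L -> f u <= sup A.
  by move=> uL; apply: ub_le_sup; [case: hsA|exists u].
exists (sup A).
suff [n [k [kn H]]] : exists n k, (k <= 2 ^ n)%N /\ sup A - e < f (grid L n k).
  by exists n, k.
apply: contrapT => H.
have [_ [u uL <-]] := sup_adherent e0 hsA.
apply/negP; rewrite -leNgt -lee_fin; apply: (dyadic_le _ _ uL).
  by move=> v v0; have [fr _] := cf; exact: fr.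
move=> n k kn; rewrite lee_fin leNgt; apply/negP => Hk; apply: H.
by exists n, k.
Qed.

Lemma measurable_if_set0 d (T : measurableType d) (b : bool) (A : set T) :
  (b -> measurable A) -> measurable (if b then A else set0).
Proof. by case: b => // mA; exact: mA. Qed.

Lemma bin_exists (R : realType) (x e : R) : 0 <= x -> 0 < e -> exists j : nat,
  e * j%:R <= x < e * j.+1%:R.
Proof.
move=> x0 e0; exists (Num.truncn (x / e)).
have := truncn_itv (divr_ge0 x0 (ltW e0)).
by rewrite ler_pdivlMr// ltr_pdivrMr// !(mulrC e).
Qed.

Lemma measure_gt0_bigcup3 d (T : measurableType d) (R : realType)
    (P : probability T R) (A : set T) (F : nat -> nat -> nat -> set T) :
  measurable A -> (forall n m j, measurable (F n m j)) ->
  A `<=` \bigcup_n \bigcup_m \bigcup_j F n m j ->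
  (0 < P A)%E -> exists n m j, (0 < P (F n m j))%E.
Proof.
move=> mA mF AF PA.
have mF1 n m : measurable (\bigcup_j F n m j) by exact: bigcupT_measurable.
have mF2 n : measurable (\bigcup_m \bigcup_j F n m j).
  exact: bigcupT_measurable.
have [n Pn] := measure_gt0_bigcup mA mF2 AF PA.
have [m Pm] := measure_gt0_bigcup (mF2 n) (mF1 n) (fun _ => id) Pn.
have [j Pj] := measure_gt0_bigcup (mF1 n m) (mF n m) (fun _ => id) Pm.
by exists n, m, j.
Qed.

Section moves.
Context d (T : measurableType d) (R : realType) (P : probability T R)
  (alpha : R) (X : R -> {RV P >-> R}).
Context (alpha_gt1 : 1 < alpha)
  (X_stable : stable_process alpha X)
  (X_laplace : forall t q : R, 0 < t -> 0 <= q ->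
       ('E_P[(fun w => expR (- (q * X t w))%R)] = (expR (t * q `^ alpha)%R)%:E)%E).

Let HX : levy_process X. Proof. by case: X_stable. Qed.
Let a0 : 0 < alpha. Proof. exact: lt_trans alpha_gt1. Qed.

Let X1_laplace q : 0 <= q ->
  ('E_P[(fun w => expR (- (q * X 1%R w))%R)] = (expR (q `^ alpha)%R)%:E)%E.
Proof. by move=> q0; rewrite X_laplace// mul1r. Qed.

(** Brings a move of uncertain duration [r] to duration 1. The bound r <= 2 protects the
    displacement, and r >= delta keeps the slack from blowing up. *)
Lemma tight_normalize delta r y e :
  0 < delta -> delta <= r -> r <= 2 -> 0 <= e -> tight X r y e ->
  exists2 l, 2^-1 `^ alpha^-1 <= l & tight X 1 (l * y) (delta^-1 `^ alpha^-1 * e).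
Proof.
move=> d0 dr r2 e0 ty; have r0 : 0 < r by exact: lt_le_trans dr.
exists (r^-1 `^ alpha^-1).
  by apply: ge0_ler_powR; rewrite ?nnegrE ?invr_ge0 ?(ltW a0) ?(ltW r0)// lef_pV2
    ?posrE.
have ri0 : 0 < r^-1 by rewrite invr_gt0.
have := tight_scale alpha_gt1 X_stable X_laplace ri0 (ltW r0) ty.
rewrite mulVf ?lt0r_neq0//; apply: tight_mono => //.
apply: ler_wpM2r => //.
by apply: ge0_ler_powR; rewrite ?nnegrE ?invr_ge0 ?(ltW a0) ?(ltW r0) ?(ltW d0)//
  lef_pV2 ?posrE.
Qed.

(** By right continuity at [s], the events for delta = 1/(n+1) cover [A]. This provides the lower
    bound on durations used in [tight_normalize]. *)
Lemma bounded_start_gt0 s (A : set T) (r : R) : 0 <= s -> 0 < r -> measurable A ->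
  (0 < P A)%E ->
  exists2 delta : R, 0 < delta <= 1 &
    (0 < P (A `&` bounded_event (shift X s) delta setT r%:E))%E.
Proof.
move=> s0 r0 mA PA.
have rS := right_continuous_shift HX s0.
have mB n : measurable (A `&` bounded_event (shift X s) (n.+1%:R^-1) setT r%:E).
  apply: measurableI => //; apply: measurable_bounded_event => //.
  by move=> u; exact: measurable_shift.
have [|n Hn] := measure_gt0_bigcup mA mB _ PA; last first.
  by exists n.+1%:R^-1 => //; rewrite invr_gt0 ltr0n/= invf_le1 ?ler1n.
move=> w Aw; have := rS w 0 (lexx _); rewrite shift0 => c0.
have [e /= e0 He] := cvgr_le 0 c0 _ r0.
have [n ne] := ltr_add_invr e0.
exists n => //; split=> //; split=> // u /andP[u0 un].
rewrite lee_fin; move: u0; rewrite le_eqVlt => /predU1P[<-|u0].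
  by rewrite shift0 ltW.
apply: He => //=; rewrite sub0r normrN gtr0_norm//.
by apply: (le_lt_trans un); rewrite add0r in ne.
Qed.

(* The near-maximum is attained at a dyadic time and its value lies in a bin of
   width e: countably many cases, so one of them has positive probability. *)
Lemma tight_up : exists2 eta : R, 0 < eta & forall e, 0 < e ->
  exists2 y, eta <= y & tight X 1 y e.
Proof.
have [eta eta0 Peta] := charges_positive alpha_gt1 X1_laplace.
have mE : measurable [set w | eta < X 1 w].
  rewrite (_ : [set _ | _] = X 1 @^-1` `]eta, +oo[%classic);
    first exact: measurable_funPTI.
  by apply/seteqP; split=> w /=; rewrite in_itv/= andbT.
have eta2 : 0 < eta / 2 by lra.
have [delta /andP[d0 d1] PA] := bounded_start_gt0 (lexx 0) eta2 mE Peta.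
set A := _ `&` _ in PA.
have mA : measurable A.
  apply: measurableI => //; apply: measurable_bounded_event => //; last 2 first.
  - exact: right_continuous_shift.
  - exact: ltW.
  by move=> u; exact: measurable_shift.
exists (2^-1 `^ alpha^-1 * (eta / 2)); first by rewrite mulr_gt0// powR_gt0.
move=> e' e'0; pose k := delta^-1 `^ alpha^-1.
have k0 : 0 < k by rewrite powR_gt0 // invr_gt0.
(* The first bound makes the slack 2 e, magnified by [k] on normalization, at most [e']; the second
   keeps the near-maximum above eta / 2. [delta], hence [k], is fixed before [e]. *)
pose e := Num.min (e' / (2 * k)) (eta / 2).
have e0 : 0 < e by rewrite lt_min eta2 divr_gt0// mulr_gt0.
have e1 : k * (2 * e) <= e'.
  have -> : k * (2 * e) = e * (2 * k) by ring.
  by rewrite -ler_pdivlMr ?mulr_gt0// ge_min lexx.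
have e2 : e <= eta / 2 by rewrite ge_min lexx orbT.
pose C n k j := [&& (k <= 2 ^ n)%N,
  delta <= grid 1 n k :> R & eta / 2 <= e * j.+1%:R].
pose F n k j := if C n k j then bounded_event X (grid 1 n k)
  `[e * j%:R, e * j.+1%:R[%classic (e * j.+1%:R + e)%:E else set0.
have mF n m j : measurable (F n m j).
  apply: measurable_if_set0 => _; apply: measurable_bounded_event => //.
    exact: right_continuous_levy.
  exact: grid_ge0.
have AF : A `<=` \bigcup_n \bigcup_m \bigcup_j F n m j.
  move=> w [/= X1 [_ Xd]].
  have [M [n [m [mn XM MX]]]] := near_argmax (levy_cadlag HX w) ler01 e0.
  have M1 : eta < M by apply: (lt_le_trans X1); apply: XM; rewrite ler01 lexx.
  have Xr : eta / 2 < X (grid 1 n m) w by lra.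
  have [j jX] := bin_exists (ltW (lt_trans eta2 Xr)) e0.
  exists n => //; exists m => //; exists j => //.
  (* Up to time [delta] the path stays below eta / 2, too low for the near-maximum. *)
  have rd : delta <= grid 1 n m.
    rewrite leNgt; apply/negP => rd.
    have := Xd (grid 1 n m); rewrite grid_ge0//= (ltW rd) => /(_ isT).
    by rewrite lee_fin /shift add0r (levy0 HX) subr0 leNgt Xr.
  have /andP[j1 j2] := jX.
  rewrite /F /C mn rd /= (_ : eta / 2 <= _); last by lra.
  split; first by rewrite /= in_itv.
  move=> u /andP[u0 ur]; rewrite lee_fin.
  apply: (@le_trans _ _ M); last by lra.
  apply: XM; rewrite u0 (le_trans ur)// -[leRHS](grid_last 1 n).
  exact: grid_le.
have [n [m [j Pj]]] := measure_gt0_bigcup3 mA mF AF PA.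
move: Pj; rewrite /F; case: ifPn => [/and3P[mn rd ej] Pj|_];
  last by rewrite measure0 ltxx.
have r2 : grid 1 n m <= 2 :> R.
  apply: (@le_trans _ _ 1); last by rewrite ler1n.
  by rewrite -[leRHS](grid_last 1 n) grid_le.
(* The target is the upper end of the bin; slack 2 e is needed to include its closed lower end, and
   leaves room for the excess e over the near-maximum. *)
have ty : tight X (grid 1 n m) (e * j.+1%:R) (2 * e).
  apply: measure_gt0S Pj.
  - apply: measurable_bounded_event => //;
      [exact: right_continuous_levy|exact: grid_ge0].
  - by apply: measurable_tight_event => //; exact: grid_ge0.
  move=> w [/= Xw H]; split.
    by move: Xw; rewrite /= !in_itv/= -natr1 mulrDr mulr1 => /andP[? ?]; apply/andP;
      split; lra.
  move=> u /H /le_trans; apply; rewrite lee_fin.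
  apply: (@le_trans _ _ (e * j.+1%:R + 2 * e)); first by lra.
  by rewrite lerD2r le_max lexx orbT.
have ee0 : 0 <= 2 * e by rewrite mulr_ge0// ltW.
have [l l1 tl] := tight_normalize d0 rd r2 ee0 ty.
exists (l * (e * j.+1%:R)).
  by apply: ler_pM => //; exact: ltW.
exact: tight_mono e1 tl.
Qed.

(* From a near-maximum onwards the path rises by at most e; the event chosen
   below keeps the near-maximum away from the final time. *)
Lemma tight_down : exists2 eta : R, 0 < eta & forall e, 0 < e ->
  exists2 y, y <= - eta & tight X 1 y e.
Proof.
have [eta eta0 Peta] := charges_negative X1_laplace.
have mE : measurable [set w | X 1 w < - eta].
  rewrite (_ : [set _ | _] = X 1 @^-1` `]-oo, - eta[%classic);
    first exact: measurable_funPTI.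
  by apply/seteqP; split=> w /=; rewrite in_itv/=.
have eta2 : 0 < eta / 2 by lra.
have [delta /andP[d0 d1] PA] := bounded_start_gt0 ler01 eta2 mE Peta.
set A := _ `&` _ in PA.
have mA : measurable A.
  apply: measurableI => //; apply: measurable_bounded_event => //; last 2 first.
  - exact: right_continuous_shift.
  - exact: ltW.
  by move=> u; exact: measurable_shift.
exists (2^-1 `^ alpha^-1 * (eta / 4)); first by rewrite mulr_gt0 ?powR_gt0//; lra.
move=> e' e'0; pose k := delta^-1 `^ alpha^-1.
have k0 : 0 < k by rewrite powR_gt0 // invr_gt0.
pose e := Num.min (e' / (2 * k)) (eta / 4).
have e0 : 0 < e by rewrite lt_min !divr_gt0// mulr_gt0.
have e1 : k * (2 * e) <= e'.
  have -> : k * (2 * e) = e * (2 * k) by ring.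
  by rewrite -ler_pdivlMr ?mulr_gt0// ge_min lexx.
have e2 : e <= eta / 4 by rewrite ge_min lexx orbT.
(* The path is run past time 1 and stays below -eta / 2 on [1, L]. A near-maximum exceeds -eta / 4,
   as X_0 = 0 and e <= eta / 4, so it precedes time 1, leaves at least [delta] to run, and is
   followed by a drop of more than eta / 4. *)
pose L := 1 + delta.
have L0 : 0 <= L by rewrite /L; lra.
pose r n m := grid L n m.
have rL n m : (m <= 2 ^ n)%N -> r n m <= L.
  by move=> mn; rewrite -[leRHS](grid_last L n) grid_le.
have r0 n m : 0 <= r n m by exact: grid_ge0.
pose C n k j := [&& (k <= 2 ^ n)%N, delta <= L - r n k :> R & eta / 4 <= e * j.+1%:R].
pose F n k j := if C n k j then bounded_event (shift X (r n k)) (L - r n k)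
  `]- (e * j.+1%:R), - (e * j%:R)]%classic e%:E else set0.
have mF n m j : measurable (F n m j).
  apply: measurable_if_set0 => /and3P[mn _ _]; apply: measurable_bounded_event => //.
  - by move=> u; exact: measurable_shift.
  - exact: right_continuous_shift.
  - by rewrite subr_ge0; exact: rL.
have AF : A `<=` \bigcup_n \bigcup_m \bigcup_j F n m j.
  move=> w [/= X1 [_ Xd]].
  have [M [n [m [mn XM MX]]]] := near_argmax (levy_cadlag HX w) L0 e0.
  have M0 : 0 <= M by have := XM 0; rewrite (levy0 HX) lexx L0; exact.
  rewrite -/(r n m) in MX.
  have X1d u : 1 <= u <= L -> X u w < - (eta / 2).
    move=> /andP[u1 uL]; have := Xd (u - 1).
    rewrite subr_ge0 u1 lerBlDl uL /shift (addrC 1) subrK lee_fin => /(_ isT); lra.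
  have Y1 : X L w < - (eta / 2) by apply: X1d; rewrite lexx andbT /L; lra.
  have r1 : r n m < 1.
    rewrite ltNge; apply/negP => r1; have := X1d (r n m);
      rewrite r1 rL//= => /(_ isT); lra.
  have Y0 : 0 <= - shift X (r n m) (L - r n m) w by rewrite /shift (addrC (r n m))
    subrK; lra.
  have [j jX] := bin_exists Y0 e0.
  exists n => //; exists m => //; exists j => //.
  have /andP[j1 j2] := jX.
  have j3 := j2; rewrite /shift (addrC (r n m)) subrK in j3.
  rewrite /F /C mn /= (_ : delta <= _); last by rewrite /L; lra.
  rewrite (_ : eta / 4 <= _); last by lra.
  split; first by rewrite /= in_itv/=; apply/andP; split; lra.
  move=> u /andP[u0 ur]; rewrite lee_fin /shift.
  have := XM (r n m + u); rewrite addr_ge0//= -lerBrDl ur => /(_ isT); lra.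
have [n [m [j Pj]]] := measure_gt0_bigcup3 mA mF AF PA.
move: Pj; rewrite /F; case: ifPn => [/and3P[mn rd ej]|_];
  last by rewrite measure0 ltxx.
have Lr0 : 0 <= L - r n m by rewrite subr_ge0; exact: rL.
(* The starting time is now deterministic, so stationarity replaces the shifted process by X. *)
rewrite (shift_bounded_event HX)// => Pj.
have r2 : L - r n m <= 2 by have := r0 n m; rewrite /L; lra.
have ty : tight X (L - r n m) (- (e * j.+1%:R)) (2 * e).
  apply: measure_gt0S Pj.
  - apply: measurable_bounded_event => //; exact: right_continuous_levy.
  - exact: measurable_tight_event.
  move=> w [/= Xw H]; split.
    by move: Xw; rewrite /= !in_itv/= -natr1 mulrDr mulr1 => /andP[? ?]; apply/andP;
      split; lra.
  move=> u /H /le_trans; apply; rewrite lee_fin.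
  apply: (@le_trans _ _ (0 + 2 * e)); first by lra.
  by rewrite lerD2r le_max lexx.
have ee0 : 0 <= 2 * e by rewrite mulr_ge0// ltW.
have [l l1 tl] := tight_normalize d0 rd r2 ee0 ty.
exists (l * - (e * j.+1%:R)).
  by rewrite mulrN lerN2; apply: ler_pM => //; lra.
exact: tight_mono e1 tl.
Qed.
End moves.

(** * Every displacement in every duration is tight *)

Lemma powR_interpolation (R : realType) (k t A B y : R) : 0 < k -> 0 < t ->
  B * t `^ k < y < A * t `^ k ->
  exists2 s, 0 < s < t & A * (t - s) `^ k + B * s `^ k = y.
Proof.
move=> k0 t0 /andP[yB yA].
(* [f] runs from A t^k to B t^k. Continuity of the power at 0 is one-sided, so the endpoints are
   treated separately. *)
pose f s := A * (t - s) `^ k + B * s `^ k.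
have pc x : 0 < x -> {for x, continuous (fun x : R => x `^ k)}.
  move=> x0; apply: differentiable_continuous; apply/derivable1_diffP.
  by apply: derivable_powR; rewrite in_itv/= x0.
have f0 : f 0 = A * t `^ k by rewrite /f powR0 ?lt0r_neq0// mulr0 addr0 subr0.
have ft : f t = B * t `^ k by rewrite /f subrr powR0 ?lt0r_neq0// mulr0 add0r.
have tsub s : (fun s => t - s) @ s --> t - s.
  by apply: cvgB; [exact: cvg_cst|exact: cvg_id].
have fcont : {within `[0, t], continuous f}.
  apply/(continuous_within_itvP f t0); split.
  - move=> s; rewrite in_itv/= => /andP[s0 st].
    apply: cvgD; (apply: cvgM; first exact: cvg_cst).
      by apply: (@cvg_comp _ _ _ (fun s => t - s) (fun x : R => x `^ k) _ (nbhs (t -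
        s))); [exact: tsub|apply: pc; rewrite subr_gt0].
    exact: pc.
  - rewrite f0 -[X in _ --> X]addr0 -{2}(mulr0 B); apply: cvgD; (apply: cvgM;
      first exact: cvg_cst); last exact: powR_cvg0.
    apply: cvg_within_filter.
    by apply: (@cvg_comp _ _ _ (fun s => t - s) (fun x : R => x `^ k) _ (nbhs t));
      [rewrite -{2}(subr0 t); exact: tsub|exact: pc].
  - rewrite ft -[X in _ --> X]add0r -(mulr0 A); apply: cvgD; (apply: cvgM;
      first exact: cvg_cst).
      apply: (@cvg_comp _ _ _ (fun s => t - s) (fun x : R => x `^ k) _ 0^'+);
        last exact: powR_cvg0.
      move=> U [e /= e0 H]; exists e => //= s ts st; apply: H => /=;
        last by rewrite subr_gt0.
      by rewrite sub0r opprB distrC.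
    by apply: cvg_within_filter; exact: pc.
have [|s] := @IVT _ f 0 t y (ltW t0) fcont.
  by rewrite f0 ft ge_min le_max (ltW yA) (ltW yB) orbT.
rewrite in_itv/= => /andP[s0 st] fs; exists s => //.
rewrite !lt_neqAle s0 st !andbT; apply/andP; split; apply/eqP => E.
  by move: fs yA; rewrite -E f0 => ->; rewrite ltxx.
by move: fs yB; rewrite E ft => ->; rewrite ltxx.
Qed.

Section tight_all.
Context d (T : measurableType d) (R : realType) (P : probability T R)
  (alpha : R) (X : R -> {RV P >-> R}).
Context (alpha_gt1 : 1 < alpha)
  (X_stable : stable_process alpha X)
  (X_laplace : forall t q : R, 0 < t -> 0 <= q ->
       ('E_P[(fun w => expR (- (q * X t w))%R)] = (expR (t * q `^ alpha)%R)%:E)%E).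

Lemma tight_all t y e : 0 < t -> 0 < e -> tight X t y e.
Proof.
move=> t0 e0.
have HX : levy_process X by case: X_stable.
have [etau etau0 up] := tight_up alpha_gt1 X_stable X_laplace.
have [etad etad0 down] := tight_down alpha_gt1 X_stable X_laplace.
pose k := alpha^-1.
have alpha0 : 0 < alpha by exact: lt_trans alpha_gt1.
have k0 : 0 < k by rewrite invr_gt0.
have k1 : 0 < 1 - k by rewrite subr_gt0 invf_lt1.
pose eta := Num.min etau etad.
have eta0 : 0 < eta by rewrite lt_min etau0.
have tk0 : 0 < t `^ k by exact: powR_gt0.
pose K := `|y| / (eta * t `^ k).
have K0 : 0 <= K by rewrite divr_ge0// ltW// mulr_gt0.
(* Makes (n+1)^(1-k) eta t^k exceed |y|: [n.+1] moves of duration t/(n+1) overshoot y in either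
   direction. The exponent 1 - k is positive because alpha > 1. *)
pose n := Num.bound (K `^ (1 - k)^-1).
have nK : K < n.+1%:R `^ (1 - k).
  have -> : K = (K `^ (1 - k)^-1) `^ (1 - k) by rewrite -powRrM mulVf ?lt0r_neq0//
    powRr1.
  apply: gt0_ltr_powR; rewrite ?nnegrE ?powR_ge0//.
  apply: (lt_trans (archi_boundP _)); first exact: powR_ge0.
  by rewrite ltr_nat.
have n0 : 0 < n.+1%:R :> R by rewrite ltr0n.
pose Q := n.+1%:R * n.+1%:R^-1 `^ k.
have QE : Q = n.+1%:R `^ (1 - k).
  rewrite /Q powRB ?lt0r_neq0 ?implybT// powRr1 ?ltW//; congr (_ * _).
  by rewrite -powR_inv1 ?ltW// -!powRrM mulN1r powRN.
have Q0 : 0 < Q by rewrite QE; exact: powR_gt0.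
have Qy : `|y| < Q * eta * t `^ k by rewrite QE -mulrA -ltr_pdivrMr ?mulr_gt0.
(* Each of the two legs has slack at most Q e' t^k, that is e / 2. *)
pose e' := e / (2 * (Q * t `^ k)).
have e'0 : 0 < e' by rewrite divr_gt0// !mulr_gt0.
have [b bu tb] := up e' e'0.
have [a ad ta] := down e' e'0.
have beta : eta <= b by rewrite ge_min bu.
have aeta : eta <= - a by rewrite ge_min; apply/orP; right; rewrite lerNr.
(* [s] is the time spent moving down, before moving up for t - s. The moves [a], [b] vary with [e'],
   so the split is found only now; their common bound [eta] made [n] available earlier. *)
have [s /andP[s0 st] sE] : exists2 s, 0 < s < t &
    Q * b * (t - s) `^ k + Q * a * s `^ k = y.
  apply: powR_interpolation => //; apply/andP; split.
    rewrite -ltrN2; apply: (@le_lt_trans _ _ `|y|); first by rewrite -normrN ler_norm.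
    apply: (lt_le_trans Qy).
    have -> : - (Q * a * t `^ k) = Q * - a * t `^ k by ring.
    by apply: ler_wpM2r; [exact: ltW|apply: ler_wpM2l => //; exact: ltW].
  apply: (@le_lt_trans _ _ `|y|); first exact: ler_norm.
  apply: (lt_le_trans Qy).
  by apply: ler_wpM2r; [exact: ltW|apply: ler_wpM2l => //; exact: ltW].
have piece u z : 0 < u -> tight X 1 z e' ->
    tight X u (Q * z * u `^ k) (Q * e' * u `^ k).
  move=> u0 tz; have un : 0 < u * n.+1%:R^-1 by rewrite mulr_gt0// invr_gt0.
  have tz' := tight_scale alpha_gt1 X_stable X_laplace un ler01 tz.
  rewrite mulr1 in tz'.
  have e1 : 0 <= (u * n.+1%:R^-1) `^ alpha^-1 * e'.
    by rewrite mulr_ge0 ?powR_ge0// ltW.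
  have := tight_iter HX n (ltW un) e1 tz'.
  rewrite -/k divfK ?lt0r_neq0// powRM ?invr_ge0 ?(ltW u0) ?(ltW n0)//.
  have QM x : u `^ k * n.+1%:R^-1 `^ k * x * n.+1%:R = Q * x * u `^ k by rewrite /Q;
    ring.
  by rewrite !QM.
have ts0 : 0 < t - s by rewrite subr_gt0.
have := tight_add HX (ltW s0) (ltW ts0) _ _ _ (piece s a s0 ta) (piece (t - s) b ts0
  tb).
have -> : s + (t - s) = t by rewrite addrC subrK.
rewrite (addrC (Q * a * s `^ k)) sE => H; apply: tight_mono (H _ _ _) => //;
  first exact: ltW.
- have mono u : 0 <= u <= t -> Q * e' * u `^ k <= Q * e' * t `^ k.
    move=> /andP[u0 ut]; apply: ler_wpM2l; first by rewrite ltW// mulr_gt0.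
    by apply: ge0_ler_powR; rewrite ?nnegrE ?(ltW k0)// (ltW t0).
  apply: (@le_trans _ _ (2 * (Q * e' * t `^ k))).
    have := mono s; have := mono (t - s);
      rewrite (ltW s0) (ltW ts0) (ltW st) gerBl (ltW s0).
    by move=> /(_ isT) + /(_ isT); lra.
  rewrite le_eqVlt; apply/orP; left; apply/eqP; rewrite /e'.
  by field; rewrite !lt0r_neq0.
- by rewrite mulr_ge0 ?powR_ge0// ltW// mulr_gt0.
- by rewrite mulr_ge0 ?powR_ge0// ltW// mulr_gt0.
- left; apply: mulr_le0_ge0; last exact: powR_ge0.
  by rewrite mulr_ge0_le0 ?(ltW Q0)//; lra.
Qed.
End tight_all.

(** * The killed density *)

Lemma killed_eventE d (T : measurableType d) (R : realType) (X : R -> T -> R) (t : R)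
    (A : set R) (c : \bar R) :
  [set w | A (X t w) /\ (running_sup X t w <= c)%E] = bounded_event X t A c.
Proof.
apply/seteqP; split=> w [Aw H]; split=> //.
  move=> u u0t; apply: le_trans H; apply: ereal_sup_ubound.
  by exists u => //=; rewrite in_itv.
apply: ge_ereal_sup => _ [u /= u0t <-]; apply: H.
by rewrite in_itv/= in u0t.
Qed.

(** [f] may change sign, as a killed density might a priori; its positive part is bounded by [k] and
    dominates the integral. *)
Lemma integral_le_cst (R : realType) (A : set R) (f : R -> R) (k : R) :
  measurable A -> measurable_fun A f -> 0 <= k -> (forall x, A x -> f x <= k) ->
  (\int[lebesgue_measure]_(x in A) (f x)%:E <= k%:E * lebesgue_measure A)%E.
Proof.
move=> mA mf k0 fk; rewrite integralE -integral_cst//.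
have mfe : measurable_fun A (EFin \o f) by exact/measurable_EFinP.
apply: (@le_trans _ _ (\int[lebesgue_measure]_(x in A) ((EFin \o f)^\+ x)))%E.
  by rewrite -[leRHS]sube0; apply: leeB => //; apply: integral_ge0 => x Ax;
    exact: funeneg_ge0.
apply: ge0_le_integral => //.
- exact: measurable_funepos.
- by move=> x Ax; rewrite funeposE/= ge_max !lee_fin fk.
Qed.

Lemma integral_ge_cst (R : realType) (A : set R) (f : R -> R) (k : R) :
  measurable A -> measurable_fun A f -> 0 <= k -> (forall x, A x -> k <= f x) ->
  (k%:E * lebesgue_measure A <= \int[lebesgue_measure]_(x in A) (f x)%:E)%E.
Proof.
move=> mA mf k0 fk; rewrite -integral_cst//.
by apply: ge0_le_integral => //; exact/measurable_EFinP.
Qed.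

Lemma measurable_fun_below (R : realType) (f : R -> R) (c : R) (A : set R) :
  (forall x, x < c -> {for x, continuous f}) -> measurable A -> A `<=` `]-oo, c[ ->
  measurable_fun A f.
Proof.
move=> cf mA Ac; apply: subspace_continuous_measurable_fun => //.
apply: continuous_in_subspaceT => x; rewrite inE => /Ac/=; rewrite in_itv/=.
exact: cf.
Qed.

Section main.
Context d (T : measurableType d) (R : realType) (P : probability T R)
  (alpha : R) (X : R -> {RV P >-> R}).
Context (alpha_gt1 : 1 < alpha)
  (X_stable : stable_process alpha X)
  (X_laplace : forall t q : R, 0 < t -> 0 <= q ->
       ('E_P[(fun w => expR (- (q * X t w))%R)] = (expR (t * q `^ alpha)%R)%:E)%E).

Let HX : levy_process X. Proof. by case: X_stable. Qed.

Lemma killed_density_gt0_dense (s a b : R) (g : R -> R) : 0 < s ->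
  is_killed_density P X 1 s g -> a < b -> b <= 1 ->
  exists2 z, a < z < b & 0 < g z.
Proof.
move=> s0 [gc gd] ab b1; apply: contrapT => H.
have Ab : `]a, b[%classic `<=` `]-oo, 1[%classic.
  by move=> x /=; rewrite !in_itv/= => /andP[_ /lt_le_trans]; apply.
have := gd `]a, b[%classic (measurable_itv _) Ab; rewrite killed_eventE => E.
have : (P (bounded_event X s `]a, b[%classic 1%:E) <= 0)%E.
  rewrite E; apply: (@le_trans _ _ (0%:E * lebesgue_measure (`]a,
    b[%classic : set R)))%E.
    apply: integral_le_cst => //; first exact: measurable_fun_below gc _ Ab.
    move=> x /=; rewrite in_itv/= => xab; rewrite leNgt; apply/negP => gx.
    by apply: H; exists x.
  by rewrite mul0e.
apply/negP; rewrite -ltNge.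
pose y := (a + b) / 2.
(* The first bound keeps the endpoint in ]a, b[, the second keeps the barrier at or below 1. *)
pose e := Num.min ((b - a) / 2) (1 - Num.max 0 y).
have y1 : y < 1 by rewrite /y; lra.
have e0 : 0 < e by rewrite lt_min divr_gt0 ?subr_gt0// gt_max ltr01.
have := tight_all alpha_gt1 X_stable X_laplace y s0 e0; apply: measure_gt0S.
- by apply: measurable_tight_event; [exact: HX|exact: ltW].
- apply: measurable_bounded_event => //; [exact: right_continuous_levy|exact: ltW].
move=> w [yw Hw]; split.
  have e1 : e <= (b - a) / 2 by rewrite ge_min lexx.
  move: yw; rewrite /= !in_itv/= /y => /andP[? ?]; apply/andP; split; lra.
move=> u /Hw /le_trans; apply; rewrite lee_fin -lerBrDl.
by rewrite ge_min lexx orbT.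
Qed.
End main.

(** * Lower bound for the convolution of killed densities *)

Section slices.
Context d (T : measurableType d) (R : realType) (P : probability T R)
  (X : R -> {RV P >-> R}) (HX : levy_process X).

Lemma slice_lower_bound (s a b e : R) (g : R -> R) : 0 < s -> a <= b -> b <= 1 -> 0
  <= e ->
  is_killed_density P X 1 s g -> (forall z, a <= z < b -> e <= g z) ->
  ((e * (b - a))%:E <= P (bounded_event X s `[a, b[%classic 1%:E))%E.
Proof.
move=> s0 ab b1 e0 [gc gd] ge.
have Ab : `[a, b[%classic `<=` `]-oo, 1[%classic.
  by move=> x /=; rewrite !in_itv/= => /andP[_ /lt_le_trans]; apply.
rewrite -killed_eventE gd//.
have mA : measurable `[a, b[%classic by exact: measurable_itv.
apply: le_trans (integral_ge_cst mA (measurable_fun_below gc mA Ab) e0 _).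
  rewrite lebesgue_measure_itv/= lte_fin; case: ltP => [//|ba].
  by rewrite mule0 lee_fin (_ : b - a = 0) ?mulr0//; lra.
by move=> z /=; rewrite in_itv/=; exact: ge.
Qed.

(* Chapman-Kolmogorov without product measures: the convolution integral is
   bounded below by a Riemann sum over disjoint slices of the midpoint. *)
Lemma convolution_lower_bound (s x y delta eta e : R) (g : R -> R) N :
  0 < s -> 0 < delta -> 0 <= e -> y + delta <= 0 -> x - y <= 1 ->
  is_killed_density P X 1 s g ->
  (forall z, y <= z < y + delta -> e <= g z) ->
  (forall z, x - y - delta <= z < x - y -> e <= g z) ->
  eta = delta / N.+1%:R ->
  ((delta * e ^+ 2 * eta)%:E <=
    P (bounded_event X (s + s)%R `[(x - eta)%R, (x + eta)%R[%classic 1%:E))%E.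
Proof.
move=> s0 d0 e0 yd xy gD gJ gC etaE.
have N0 : 0 < N.+1%:R :> R by rewrite ltr0n.
have eta0 : 0 < eta by rewrite etaE divr_gt0.
have Neta : N.+1%:R * eta = delta by rewrite etaE mulrC divfK// lt0r_neq0.
pose J i := `[y + i%:R * eta, y + i.+1%:R * eta[%classic.
(* Slices reflected against [J i]: a position in [J i] plus a displacement in [C i] falls in [x -
   eta, x + eta[. *)
pose C i := `[x - y - i.+1%:R * eta, x - y - i%:R * eta[%classic.
pose G i := bounded_event X s (J i) 1%:E `&` bounded_event (shift X s) s (C i) 1%:E.
have s0' := ltW s0.
have mJ i : measurable (J i) by exact: measurable_itv.
have mC i : measurable (C i) by exact: measurable_itv.
have mG i : measurable (G i).
  apply: measurableI; apply: measurable_bounded_event => //.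
  - exact: right_continuous_levy.
  - by move=> u; exact: measurable_shift.
  - exact: right_continuous_shift.
have iN i : (i < N.+1)%N -> 0 <= i%:R * eta /\ i.+1%:R * eta <= delta.
  move=> iN; split; first by rewrite mulr_ge0// ltW.
  by rewrite -Neta ler_pM2r// ler_nat.
have iS i : i.+1%:R * eta = i%:R * eta + eta by rewrite -natr1 mulrDl mul1r.
have tG : trivIset setT G.
  have wlog_lt i j : (i < j)%N -> G i `&` G j !=set0 -> False.
    move=> ij [w [[[/= + _] _] [[/= + _] _]]]; rewrite /J /= !in_itv/=.
    have : i.+1%:R * eta <= j%:R * eta by rewrite ler_pM2r// ler_nat.
    by move=> ? /andP[? ?] /andP[? ?]; lra.
  move=> i j _ _ Gij; apply/eqP; rewrite eqn_leq; apply/andP; split; rewrite leqNgt;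
    apply/negP => ij.
    by apply: (wlog_lt j i ij); rewrite setIC.
  exact: (wlog_lt i j ij).
have PG i : (i < N.+1)%N -> (((e * eta) * (e * eta))%:E <= P (G i))%E.
  move=> /iN [i0 i1]; rewrite /G (bounded_event_indep HX _ _ s0' s0' (mJ i) (mC i))
    EFinM; have Si := iS i.
  have ee0 : 0 <= e * eta by rewrite mulr_ge0// ltW.
  apply: lee_pmul; rewrite ?lee_fin//.
    have -> : eta = y + i.+1%:R * eta - (y + i%:R * eta) by lra.
    apply: slice_lower_bound gD _ => //; try lra.
    by move=> z /andP[? ?]; apply: gJ; apply/andP; split; lra.
  have -> : eta = x - y - i%:R * eta - (x - y - i.+1%:R * eta) by lra.
  apply: slice_lower_bound gD _ => //; try lra.
  by move=> z /andP[? ?]; apply: gC; apply/andP; split; lra.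
have mU : measurable (\big[setU/set0]_(i < N.+1) G i) by exact: bigsetU_measurable.
apply: (@le_trans _ _ (P (\big[setU/set0]_(i < N.+1) G i))).
  (* [N.+1] disjoint events of probability at least (e eta)^2, with (N+1) eta = delta, give a total
     linear in [eta], like the length of the window around x. *)
  rewrite (measure_semi_additive _ _ mG tG mU).
  apply: (@le_trans _ _ (\sum_(i < N.+1) ((e * eta) * (e * eta))%:E)%E).
    rewrite sumEFin lee_fin sumr_const card_ord -mulr_natl -{1}Neta.
    by rewrite le_eqVlt; apply/orP; left; apply/eqP; ring.
  by apply: lee_sum => i _; exact: PG.
have ss0 : 0 <= s + s by rewrite addr_ge0.
rewrite le_measure ?inE//.
  by apply: measurable_bounded_event => //; exact: right_continuous_levy.
rewrite -bigcup_mkord => w [i /= /iN [i0 i1]] [[Jw Hw] [Cw Kw]].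
have Si := iS i.
have XJ : X s w < 0 by move: Jw; rewrite /J /= in_itv/= => /andP[? ?]; lra.
split.
  move: Jw Cw; rewrite /J /C /shift /= !in_itv/= => /andP[? ?] /andP[? ?].
  by apply/andP; split; lra.
move=> u /andP[u0 us]; have [us'|su] := leP u s; first by apply: Hw; rewrite u0 us'.
have := Kw (u - s); rewrite subr_ge0 (ltW su) lerBlDl us => /(_ isT).
by rewrite /shift (addrC s) subrK !lee_fin; lra.
Qed.
End slices.

Theorem corollary3 (R : realType) (d : measure_display) (T : measurableType d)
    (P : probability T R) (alpha : R) (X : R -> {RV P >-> R})
    (h1 : R -> R -> R)
    (alpha_gt1 : 1 < alpha) (alpha_lt2 : alpha < 2)
    (X_stable : stable_process alpha X)
    (X_laplace : forall t q : R, 0 < t -> 0 <= q ->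
       ('E_P[(fun w => expR (- (q * X t w))%R)] = (expR (t * q `^ alpha)%R)%:E)%E)
    (h1_density : forall t : R, 0 < t ->
       is_killed_density P X 1 t (fun x => h1 x t))
    (x t : R) (x_lt1 : x < 1) (t_gt0 : 0 < t) :
  0 < h1 x t.
Proof.
have HX : levy_process X by case: X_stable.
pose s := t / 2; have s0 : 0 < s by rewrite divr_gt0.
have ts : t = s + s by rewrite /s; lra.
pose g z := h1 z s; have gD : is_killed_density P X 1 s g by exact: h1_density.
have [gc _] := gD.
have dense := killed_density_gt0_dense alpha_gt1 X_stable X_laplace s0 gD.
have [|y1 /andP[xy1 y10] gy1] := dense (x - 1) 0 _ ler01; first by lra.
have y11 : y1 < 1 by lra.
have [r /= r0 Hr] := cvgr_gt (g y1) (gc y1 y11) _ gy1.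
pose lo := Num.max (y1 - r) (x - 1); pose hi := Num.min (y1 + r) 0.
have lohi : lo < hi by rewrite /lo /hi gt_max !lt_min; apply/andP; split;
  apply/andP; split; lra.
have xlo : x - lo <= 1 by rewrite lerBlDr -lerBlDl le_max lexx orbT.
(* [g] is positive on all of ]lo, hi[, so the midpoint can be moved there until the remaining
   displacement z = x - y also has positive density. *)
have [|z /andP[z1 z2] gz] := dense (x - hi) (x - lo) _ xlo;
  first by rewrite ltrD2l ltrN2.
pose y := x - z.
have hir : hi <= y1 + r by rewrite ge_min lexx.
have hi0 : hi <= 0 by rewrite ge_min lexx orbT.
have lor : y1 - r <= lo by rewrite le_max lexx.
have gy : 0 < g y.
  by apply: Hr => /=; rewrite ltr_norml /y; apply/andP; split; lra.
pose e := Num.min (g y) (g z) / 2.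
have e0 : 0 < e by rewrite divr_gt0// lt_min gy.
have egy : e < g y.
  have : Num.min (g y) (g z) <= g y by rewrite ge_min lexx.
  by rewrite /e; lra.
have egz : e < g z.
  have : Num.min (g y) (g z) <= g z by rewrite ge_min lexx orbT.
  by rewrite /e; lra.
have yl1 : y < 1 by rewrite /y; lra.
have zl1 : z < 1 by lra.
have [r1 /= r10 H1] := cvgr_gt (g y) (gc y yl1) _ egy.
have [r2 /= r20 H2] := cvgr_gt (g z) (gc z zl1) _ egz.
pose delta := Num.min (Num.min r1 r2) (- y) / 2.
have m0 : 0 < Num.min (Num.min r1 r2) (- y) by rewrite !lt_min r10 r20/= /y; lra.
have d0 : 0 < delta by rewrite divr_gt0.
have dr1 : delta < r1.
  have : Num.min (Num.min r1 r2) (- y) <= r1 by rewrite !ge_min lexx.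
  by move: m0; rewrite /delta; lra.
have dr2 : delta < r2.
  have : Num.min (Num.min r1 r2) (- y) <= r2 by rewrite !ge_min lexx orbT.
  by move: m0; rewrite /delta; lra.
have dy : y + delta <= 0.
  have : Num.min (Num.min r1 r2) (- y) <= - y by rewrite !ge_min lexx orbT.
  by move: m0; rewrite /delta; lra.
have gJ v : y <= v < y + delta -> e <= g v.
  by move=> /andP[? ?]; apply/ltW/H1 => /=; rewrite ltr_norml; apply/andP; split; lra.
have gC v : x - y - delta <= v < x - y -> e <= g v.
  rewrite /y => /andP[? ?]; apply/ltW/H2 => /=; rewrite ltr_norml; apply/andP;
    split; lra.
have xy : x - y <= 1 by rewrite /y; lra.
rewrite ltNge; apply/negP => fx.
have [fc fd] := h1_density t t_gt0.
(* If h_1(x, t) <= 0, continuity keeps the density below [k] on a window of length 2 eta, whose mass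
   is then at most half of the lower bound delta e^2 eta. *)
pose k := delta * e ^+ 2 / 4.
have k0 : 0 < k by rewrite divr_gt0// mulr_gt0// exprn_gt0.
have [r3 /= r30 H3] := cvgr_lt (h1 x t) (fc x x_lt1) k (le_lt_trans fx k0).
pose rho := Num.min r3 (1 - x).
have rho0 : 0 < rho by rewrite lt_min r30 subr_gt0.
pose N := Num.bound (delta / rho).
pose eta := delta / N.+1%:R.
have N0 : 0 < N.+1%:R :> R by rewrite ltr0n.
have eta0 : 0 < eta by rewrite divr_gt0.
have eta_rho : eta < rho.
  rewrite /eta ltr_pdivrMr// mulrC -ltr_pdivrMr//.
  apply: (lt_trans (archi_boundP _)); first by rewrite divr_ge0// ltW.
  by rewrite ltr_nat.
have rho3 : rho <= r3 by rewrite ge_min lexx.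
have rho1 : rho <= 1 - x by rewrite ge_min lexx orbT.
pose I := `[x - eta, x + eta[%classic.
have Asub : I `<=` `]-oo, 1[%classic.
  by move=> v; rewrite /I /= !in_itv/= => /andP[? ?]; lra.
have PE := fd _ (measurable_itv _) Asub; rewrite killed_eventE in PE.
have := convolution_lower_bound HX (N := N) s0 d0 (ltW e0) dy xy gD gJ gC (erefl eta).
rewrite -ts {}PE; apply/negP; rewrite -ltNge.
apply: (@le_lt_trans _ _ (k%:E * lebesgue_measure I))%E.
  have mI : measurable I by exact: measurable_itv.
  apply: (integral_le_cst mI (measurable_fun_below fc mI Asub) (ltW k0)).
  move=> v; rewrite /I /= in_itv/= => /andP[? ?]; apply/ltW/H3 => /=.
  by rewrite ltr_norml; apply/andP; split; lra.
have xe : x - eta < x + eta by lra.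
rewrite /I lebesgue_measure_itv/= lte_fin xe.
rewrite -EFinB -EFinM lte_fin /k.
have -> : x + eta - (x - eta) = 2 * eta by ring.
have -> : delta * e ^+ 2 / 4 * (2 * eta) = delta * e ^+ 2 * eta / 2 by field.
rewrite ltr_pdivrMr// ltr_pMr ?ltr1n//.
by rewrite mulr_gt0// mulr_gt0// exprn_gt0.
Qed.
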